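(* In the setting described in the context, assume that the theta series $\theta_\Lambda$ (for all full-rank lattices $\Lambda\subset\widehat U$) satisfies the identities (T1)--(T5) listed there. Then there is a formally real Jordan algebra structure $\mathfrak A$ on $V$ with unit element $e$ for which $j(z)=-z^{-1}$ on $\mathcal H(Y)$ and $Y$ is the set of all squares of invertible elements, and for this Jordan algebra $\mathfrak A$ the identity $$\psi(x^{-1})=\psi(x)^{-1}$$ holds for all invertible $x\in\mathfrak A$; thus $\psi$ is a Jordan homomorphism from $\mathfrak A$ to $\mathrm{Sym}(\widehat U)$, and $\mathfrak A$ is special. Moreover, in the theta transformation formula (T5) one has $J(z)=\pm\psi(z)^{-1}$ (i.e. $J$ equals $z\mapsto\psi(z)^{-1}$ up to replacing $J$ by its negative).
   Context: All vector spaces are finite-dimensional. $\widehat U\neq\{0\}$ is a real vector space with complexification $U=\widehat U^{\mathbb C}$; $\rho$ is a positive definite symmetric bilinear form on $\widehat U$, extended $\mathbb C$-bilinearly to $U$; $B^\rho$ denotes the adjoint of $B$ with respect to $\rho$. For a full-rank lattice $\Lambda\subset\widehat U$, $\Lambda^\rho=\{x\in\widehat U:\rho(\Lambda,x)\subseteq\mathbb Z\}$ is the dual lattice. $V$ is a real vector space with complexification $V^{\mathbb C}$, and $\psi:V^{\mathbb C}\to\mathrm{End}_{\mathbb C}(U)$ is an injective $\mathbb C$-linear map such that for every $x\in V$ the map $\psi(x)$ sends $\widehat U$ to itself and is self-adjoint with respect to $\rho$. Put $Y=\{x\in V:\rho(\psi(x)u,u)>0\text{ for all }u\in\widehat U\setminus\{0\}\}$;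 it is assumed that $Y\neq\emptyset$, and then $Y$ is an open convex cone in $V$ which is regular (contains no full line). A base point $e\in Y$ with $\psi(e)=I$ is fixed. $\mathcal H(Y)=V\oplus iY\subset V^{\mathbb C}$ is the tube domain over $Y$. For a full-rank lattice $\Lambda$ in $\widehat U$ the theta series is $$\theta_\Lambda(z,u)=\sum_{l\in\Lambda^\rho}\exp\bigl(\pi i\,\rho(\psi(z)l+2u,l)\bigr),\qquad (z,u)\in\mathcal H(Y)\times U,$$ which converges absolutely; thus in $\theta_{\Lambda^\rho}$ the sum is over $(\Lambda^\rho)^\rho=\Lambda$. The identities, for every full-rank lattice $\Lambda\subset\widehat U$ and all $(z,u)\in\mathcal H(Y)\times U$, are: (T1) $\theta_\Lambda(z,u+m)=\theta_\Lambda(z,u)$ for all $m\in\Lambda$. (T2) $\theta_\Lambda(z,u+\psi(z)n)=\exp(-\pi i\,\rho(\psi(z)n+2u,n))\,\theta_\Lambda(z,u)$ for all $n\in\Lambda^\rho$. (T3) $\theta_\Lambda(z+k,u)=\theta_\Lambda(z,u)$ for all $k\in\mathcal L=\{x\in V:\rho(\psi(x)l,l)\in2\mathbb Z\text{ for all }l\in\Lambda^\rho\}$. (T4) $\theta_{\widehat W\Lambda}(Wz,\widehat Wu)=\theta_\Lambda(z,u)$ for all $W\in GL(V)$, $\widehat W\in GL(\widehat U)$ with $\psi(Wx)=\widehat W\psi(x)\widehat W^\rho$ for all $x\in V^{\mathbb C}$. (T5) (theta transformation formula) $\theta_{\Lambda^\rho}(j(z),J(z)u)=c_\Lambda\cdot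 H(z,u)\cdot\theta_\Lambda(z,u)$, where: $j:\mathcal H(Y)\to\mathcal H(Y)$ is a non-affine holomorphic map with $j\circ j=\mathrm{id}$, $j(ie)=ie$ and derivative $dj(ie)=-I$; $J:\mathcal H(Y)\to\mathrm{End}(U)$ is holomorphic; $H:\mathcal H(Y)\times U\to\mathbb C$ is holomorphic, without zeros, and normalized by $H(ie,0)=1$; $j,J,H$ are independent of $\Lambda$; and $c_\Lambda$ is a constant depending only on $\Lambda$. $\mathrm{Sym}(\widehat U)$ is the Jordan algebra of $\rho$-self-adjoint endomorphisms of $\widehat U$ with product $\frac12(AB+BA)$. A Jordan algebra is special if it is isomorphic to a Jordan subalgebra of an associative algebra with product $\frac12(ab+ba)$. *)

(* Defs.v *)
From HB Require Import structures.
From mathcomp Require Import all_boot all_order all_algebra.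
From mathcomp Require Import sesquilinear.
From mathcomp Require Import all_classical all_reals all_analysis.
From mathcomp Require Import complex.
From mathcomp.analysis.showcase Require summability.

Set Implicit Arguments.
Unset Strict Implicit.
Unset Printing Implicit Defensive.

Import Order.TTheory GRing.Theory Num.Theory.
Import numFieldNormedType.Exports.

Local Open Scope classical_set_scope.
Local Open Scope ring_scope.

(* R[i] as a numClosedFieldType: matrices over Cx R thereby get their normed
   Cx R-module structure, so that `differentiable` and `'d` are the complex
   (Frechet) notions. *)
Definition Cx (R : realType) : numClosedFieldType := R[i].

(* Finite-dimensional real spaces are coordinatized as 'cV[R]_n, with
   complexification 'cV[Cx R]_n; real endomorphisms are matrices 'M[R]_n
   acting on columns. *)
Section Complexification.
Variable R : realType.

Definition mkC p q (a b : 'M[R]_(p, q)) : 'M[Cx R]_(p, q) :=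
  \matrix_(i, k) ((a i k +i* b i k)%C : Cx R).
Definition toC p q (a : 'M[R]_(p, q)) : 'M[Cx R]_(p, q) := mkC a 0.
Definition reM p q (z : 'M[Cx R]_(p, q)) : 'M[R]_(p, q) :=
  \matrix_(i, k) complex.Re (z i k).
Definition imM p q (z : 'M[Cx R]_(p, q)) : 'M[R]_(p, q) :=
  \matrix_(i, k) complex.Im (z i k).

Definition expC (z : Cx R) : Cx R :=
  ((expR (complex.Re z) * cos (complex.Im z)) +i*
   (expR (complex.Re z) * sin (complex.Im z)))%C.

Definition holomorphic_on (E F : normedModType (Cx R)) (D : set E)
  (f : E -> F) : Prop := forall z, D z -> differentiable f z.

End Complexification.

Section Jordan.
Variables (K : fieldType).

Definition jordan_algebra (V : lmodType K) (mul : V -> V -> V) : Prop :=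
  [/\ forall y, linear (fun x => mul x y),
      forall x, linear (mul x),
      forall x y, mul x y = mul y x
    & forall x y, mul (mul (mul x x) y) x = mul (mul x x) (mul y x)].

Definition jordan_unit (V : lmodType K) (mul : V -> V -> V) (e : V) : Prop :=
  forall x, mul e x = x /\ mul x e = x.

Definition formally_real (V : lmodType K) (mul : V -> V -> V) : Prop :=
  forall s : seq V, \sum_(x <- s) mul x x = 0 -> forall x, x \in s -> x = 0.

(* y is the inverse of x: x o y = e and x^2 o y = x. The second equation makes
   y unique, which x o y = e alone does not in a Jordan algebra. *)
Definition jordan_inverse (V : lmodType K) (mul : V -> V -> V) (e x y : V) :
  Prop := mul x y = e /\ mul (mul x x) y = x.

Definition jordan_invertible (V : lmodType K) (mul : V -> V -> V) (e x : V) :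
  Prop := exists y, jordan_inverse mul e x y.

Definition jprod (A : algType K) (a b : A) : A := 2^-1 *: (a * b + b * a).

Definition jordan_subalgebra (A : algType K) (S : set A) : Prop :=
  [/\ S 0, forall (k : K) a b, S a -> S b -> S (k *: a + b)
    & forall a b, S a -> S b -> S (jprod a b)].

Definition jordan_special (V : lmodType K) (mul : V -> V -> V) : Prop :=
  exists (A : algType K) (S : set A) (f : {linear V -> A}),
    [/\ jordan_subalgebra S, set_bij setT S f
      & forall x y, f (mul x y) = jprod (f x) (f y)].

End Jordan.

Section Theta.
Variables (R : realType) (n m : nat).
Variables (rho : {dot 'cV[R]_n for idfun}).
Variables (psi : {linear 'cV[Cx R]_m -> 'M[Cx R]_n}).

Definition rhoC (u v : 'cV[Cx R]_n) : Cx R :=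
  ((rho (reM u) (reM v) - rho (imM u) (imM v)) +i*
   (rho (reM u) (imM v) + rho (imM u) (reM v)))%C.

Definition mul_cplx (mul : 'cV[R]_m -> 'cV[R]_m -> 'cV[R]_m)
    (z w : 'cV[Cx R]_m) : 'cV[Cx R]_m :=
  mkC (mul (reM z) (reM w) - mul (imM z) (imM w))
      (mul (reM z) (imM w) + mul (imM z) (reM w)).

Definition adjoint_of (B B' : 'M[R]_n) : Prop :=
  forall u v : 'cV[R]_n, rho (B *m u) v = rho u (B' *m v).

Definition Sym : set 'M[R]_n := [set A | adjoint_of A A].

Definition jordan_hom_Sym (mul : 'cV[R]_m -> 'cV[R]_m -> 'cV[R]_m)
    (f : {linear 'cV[R]_m -> 'M[R]_n}) : Prop :=
  (forall x, Sym (f x)) /\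
  (forall x y, f (mul x y) = 2^-1 *: (f x *m f y + f y *m f x)).

Definition cone : set 'cV[R]_m :=
  [set x | forall u : 'cV[R]_n, u != 0 ->
             0 < rhoC (psi (toC x) *m toC u) (toC u)].

Definition tube : set 'cV[Cx R]_m := [set z | cone (imM z)].

Definition full_lattice (L : set 'cV[R]_n) : Prop :=
  exists2 B : 'M[R]_n, B \in unitmx &
    L = [set B *m map_mx intr k | k in [set: 'cV[int]_n]].

Definition dual_lattice (L : set 'cV[R]_n) : set 'cV[R]_n :=
  [set x | forall l, L l -> rho l x \is a Num.int].

(* Unconditional sum over the dual lattice: the limit of the finite partial
   sums along the directed set of finite subsets. *)
Definition theta (L : set 'cV[R]_n) (z : 'cV[Cx R]_m) (u : 'cV[Cx R]_n) :
    Cx R :=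
  summability.sum (fun l : 'cV[R]_n =>
    if l \in dual_lattice L then
      expC ((0 +i* pi)%C * rhoC (psi z *m toC l + 2 *: u) (toC l)) : Cx R
    else 0).

Definition theta_T1 : Prop :=
  forall L, full_lattice L -> forall z u m0, tube z -> L m0 ->
    theta L z (u + toC m0) = theta L z u.

Definition theta_T2 : Prop :=
  forall L, full_lattice L -> forall z u l, tube z -> dual_lattice L l ->
    theta L z (u + psi z *m toC l) =
    expC (- (0 +i* pi)%C * rhoC (psi z *m toC l + 2 *: u) (toC l)) *
      theta L z u.

Definition theta_T3 : Prop :=
  forall L, full_lattice L -> forall z u (k : 'cV[R]_m), tube z ->
    (forall l, dual_lattice L l -> exists a : int,
       rhoC (psi (toC k) *m toC l) (toC l) = (2 * a)%:~R) ->
    theta L (z + toC k) u = theta L z u.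

Definition theta_T4 : Prop :=
  forall L, full_lattice L -> forall z u, tube z ->
    forall (W : 'M[R]_m) (What What' : 'M[R]_n),
    W \in unitmx -> What \in unitmx -> adjoint_of What What' ->
    (forall x, psi (toC W *m x) = toC What *m psi x *m toC What') ->
    theta [set What *m l | l in L] (toC W *m z) (toC What *m u) = theta L z u.

Definition theta_T5 (j : 'cV[Cx R]_m -> 'cV[Cx R]_m)
    (J : 'cV[Cx R]_m -> 'M[Cx R]_n) (H : 'cV[Cx R]_m * 'cV[Cx R]_n -> Cx R)
    (c : set 'cV[R]_n -> Cx R) : Prop :=
  forall L, full_lattice L -> forall z u, tube z ->
    theta (dual_lattice L) (j z) (J z *m u) = c L * H (z, u) * theta L z u.

End Theta.

(* Main.v *)
Require Import Defs.
From HB Require Import structures.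
From mathcomp Require Import all_boot all_order all_algebra.
From mathcomp Require Import sesquilinear.
From mathcomp Require Import all_classical all_reals all_analysis.
From mathcomp Require Import complex.
From mathcomp Require Import finmap zify ring lra.
From mathcomp.analysis.showcase Require summability.

Set Implicit Arguments.
Unset Strict Implicit.
Unset Printing Implicit Defensive.

Import Order.TTheory GRing.Theory Num.Theory.
Import numFieldNormedType.Exports.

Local Open Scope classical_set_scope.
Local Open Scope ring_scope.

(** The idea is that the theta series at (z, u) tends to 1 when the dual lattice
    is scaled up, since its terms away from the origin then vanish
    (theta_near1). Because the factor H of the transformation formula does not
    depend on the lattice, this one limit, combined with the quasi-periodicity
    of the series, extracts from the formula identities without any lattice.

    Fix z in the tube domain. Making one of the two series in the formula
    trivial, one finds how H (z, -) behaves under the translations by psi z l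
    (H_shift), and by the solutions x of J z x = psi (j z) l (H_shift_J), for
    all real vectors l. That these translations commute expresses the pairing of
    x with the real vectors through J z psi z (shift_commute); in particular J z
    is injective. On the other hand H_shift makes J z psi z l a true period of
    the series at j z, and the interplay of periods and quasi-periods forces
    integral pairings (period_int): J z psi z sends every lattice into itself.
    Only integers k do so (integral_conjugates_scalar). Hence J z psi z = k, and
    shift_commute becomes psi z psi (j z) = - k ^ 2. The point ie is fixed by j,
    which gives k = 1 or k = -1 there, and k does not vary on the tube domain
    because it is continuous in z (J_psi_const).

    So psi z psi (j z) = -1: the range of psi on V contains the inverses of its
    positive elements. By Hua's identity it is then closed under squares
    (hua_range, square_range), so that the Jordan product of symmetric operators
    can be transported to V. The cone consists of squares of invertible elements
    because the square root of a positive operator is a polynomial in it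
    (sqrt_poly, pos_squares). *)

(** * Complexification *)

Section Complexification.
Variable R : realType.

Lemma ReD (x y : Cx R) : complex.Re (x + y) = complex.Re x + complex.Re y.
Proof. by case: x; case: y. Qed.

Lemma ImD (x y : Cx R) : complex.Im (x + y) = complex.Im x + complex.Im y.
Proof. by case: x; case: y. Qed.

Lemma ReM (x y : Cx R) : complex.Re (x * y) =
  complex.Re x * complex.Re y - complex.Im x * complex.Im y.
Proof. by case: x; case: y. Qed.

Lemma ImM (x y : Cx R) : complex.Im (x * y) =
  complex.Re x * complex.Im y + complex.Im x * complex.Re y.
Proof. by case: x; case: y. Qed.

Lemma ReN (x : Cx R) : complex.Re (- x) = - complex.Re x.
Proof. by case: x. Qed.

Lemma ImN (x : Cx R) : complex.Im (- x) = - complex.Im x.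
Proof. by case: x. Qed.

Lemma Cx_eq (x y : Cx R) :
  complex.Re x = complex.Re y -> complex.Im x = complex.Im y -> x = y.
Proof. by case: x y => a b [c d] /= -> ->. Qed.

Definition imag : Cx R := (0 +i* 1)%C.

Lemma imag2 : imag * imag = -1.
Proof. by apply: Cx_eq; rewrite ?(ReM, ImM, ReN, ImN)/=; ring. Qed.

Lemma toCE p q (a : 'M[R]_(p, q)) : toC a = map_mx (real_complex R) a.
Proof. by apply/matrixP => i k; rewrite !mxE. Qed.

Lemma toCM p q r (a : 'M[R]_(p, q)) (b : 'M[R]_(q, r)) :
  toC (a *m b) = toC a *m toC b.
Proof. by rewrite !toCE; apply: map_mxM. Qed.

Lemma toCD p q (a b : 'M[R]_(p, q)) : toC (a + b) = toC a + toC b.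
Proof. by rewrite !toCE; apply: map_mxD. Qed.

Lemma toCN p q (a : 'M[R]_(p, q)) : toC (- a) = - toC a.
Proof. by rewrite !toCE; apply: map_mxN. Qed.

Lemma toC0 p q : toC (0 : 'M[R]_(p, q)) = 0.
Proof. by rewrite !toCE; apply: map_mx0. Qed.

Lemma toCZ p q k (a : 'M[R]_(p, q)) :
  toC (k *: a) = (real_complex R k : Cx R) *: toC a.
Proof. by rewrite !toCE; apply: map_mxZ. Qed.

Lemma toC1 p : toC (1%:M : 'M[R]_p) = 1%:M.
Proof. by rewrite !toCE; apply: map_mx1. Qed.

Lemma toC_tr p q (a : 'M[R]_(p, q)) : (toC a)^T = toC a^T.
Proof. by apply/matrixP => i k; rewrite !mxE. Qed.

Lemma toC_inj p q : injective (@toC R p q).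
Proof.
by move=> a b /matrixP ab; apply/matrixP => i k; move: (ab i k);
  rewrite !mxE => -[].
Qed.

Lemma toC_unit p (a : 'M[R]_p) : (toC a \in unitmx) = (a \in unitmx).
Proof. by rewrite toCE; apply: map_unitmx. Qed.

Lemma toC_inv p (a : 'M[R]_p) : toC (invmx a) = invmx (toC a).
Proof. by rewrite !toCE; apply: map_invmx. Qed.

Lemma mkCE p q (a b : 'M[R]_(p, q)) : mkC a b = toC a + imag *: toC b.
Proof.
by apply/matrixP => i k; rewrite !mxE; apply: Cx_eq;
  rewrite ?(ReD, ImD, ReM, ImM)/=; ring.
Qed.

Lemma reM_mkC p q (a b : 'M[R]_(p, q)) : reM (mkC a b) = a.
Proof. by apply/matrixP => i k; rewrite !mxE. Qed.

Lemma imM_mkC p q (a b : 'M[R]_(p, q)) : imM (mkC a b) = b.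
Proof. by apply/matrixP => i k; rewrite !mxE. Qed.

Lemma mkC_re_im p q (z : 'M[Cx R]_(p, q)) : mkC (reM z) (imM z) = z.
Proof. by apply/matrixP => i k; rewrite !mxE; case: (z i k). Qed.

Lemma reM_toC p q (a : 'M[R]_(p, q)) : reM (toC a) = a.
Proof. exact: reM_mkC. Qed.

Lemma mkCP p q (z : 'M[Cx R]_(p, q)) : z = toC (reM z) + imag *: toC (imM z).
Proof. by rewrite -mkCE mkC_re_im. Qed.

Lemma mkCM p q r (a b : 'M[R]_(p, q)) (c d : 'M[R]_(q, r)) :
  mkC a b *m mkC c d = mkC (a *m c - b *m d) (a *m d + b *m c).
Proof.
rewrite !mkCE !(toCM, toCD, toCN) mulmxDl !mulmxDr.
rewrite -!scalemxAl -!scalemxAr scalerA imag2 scaleN1r scalerDr.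
by rewrite -!addrA; congr (_ + _); rewrite addrA addrC.
Qed.

Lemma mkC_inj p q (a b c d : 'M[R]_(p, q)) : mkC a b = mkC c d ->
  a = c /\ b = d.
Proof.
by move=> E; move: (congr1 (@reM _ _ _) E) (congr1 (@imM _ _ _) E);
  rewrite !reM_mkC !imM_mkC.
Qed.

End Complexification.

(** * Bilinear forms given by a matrix *)

Section MatrixForm.
Variables (F : comPzRingType) (n : nat) (S : 'M[F]_n).
Implicit Types u v w : 'cV[F]_n.

Definition sdot u v : F := (u^T *m S *m v) 0 0.

Lemma sdotDl u v w : sdot (u + v) w = sdot u w + sdot v w.
Proof. by rewrite /sdot linearD /= !mulmxDl mxE. Qed.

Lemma sdotDr u v w : sdot u (v + w) = sdot u v + sdot u w.
Proof. by rewrite /sdot mulmxDr mxE. Qed.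

Lemma sdotZl k u v : sdot (k *: u) v = k * sdot u v.
Proof. by rewrite /sdot linearZ /= -!scalemxAl mxE. Qed.

Lemma sdotZr k u v : sdot u (k *: v) = k * sdot u v.
Proof. by rewrite /sdot -!scalemxAr mxE. Qed.

Lemma sdotNl u v : sdot (- u) v = - sdot u v.
Proof. by rewrite -scaleN1r sdotZl mulN1r. Qed.

Lemma sdotNr u v : sdot u (- v) = - sdot u v.
Proof. by rewrite -scaleN1r sdotZr mulN1r. Qed.

Lemma sdot0l u : sdot 0 u = 0.
Proof. by rewrite -(scale0r 0) sdotZl mul0r. Qed.

Lemma sdot0r u : sdot u 0 = 0.
Proof. by rewrite -(scale0r 0) sdotZr mul0r. Qed.

Lemma sdot_sym : S^T = S -> forall u v, sdot u v = sdot v u.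
Proof.
move=> ST u v; have E : v^T *m S *m u = (u^T *m S *m v)^T.
  by rewrite !trmx_mul trmxK ST mulmxA.
by rewrite /sdot E [RHS]mxE.
Qed.

Lemma sdot_adj (A B : 'M[F]_n) : A^T *m S = S *m B ->
  forall u v, sdot (A *m u) v = sdot u (B *m v).
Proof. by move=> AB u v; rewrite /sdot trmx_mul -!mulmxA (mulmxA A^T) AB
  !mulmxA. Qed.

End MatrixForm.

Lemma sdot_eqr (F : fieldType) n (S : 'M[F]_n) u v : S \in unitmx ->
  (forall i, sdot S u (delta_mx i 0) = sdot S v (delta_mx i 0)) -> u = v.
Proof.
move=> US uv; apply/trmx_inj/(can_inj (mulmxK US)).
apply/matrixP => i k; rewrite ord1; move: (uv k).
by rewrite /sdot -!colE !mxE.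
Qed.

Lemma unitmx_ker (F : fieldType) n (A : 'M[F]_n) :
  (forall v : 'cV_n, A *m v = 0 -> v = 0) -> A \in unitmx.
Proof.
move=> A0; rewrite -unitmx_tr -row_free_unit; apply: inj_row_free => v vA.
apply: trmx_inj; rewrite trmx0; apply: A0.
by rewrite -[A]trmxK -trmx_mul vA trmx0.
Qed.

Section PositiveForm.
Variables (R : realType) (n : nat).

Definition posdef (S : 'M[R]_n) := forall u, u != 0 -> 0 < sdot S u u.

Variable S : 'M[R]_n.
Hypotheses (ST : S^T = S) (Spos : posdef S).

Lemma posdef_ge0 u : 0 <= sdot S u u.
Proof. by have [->|/Spos/ltW//] := eqVneq u 0; rewrite sdot0l. Qed.

Lemma posdef_eq0 u : sdot S u u = 0 -> u = 0.
Proof. by move=> u0; apply/eqP/negPn/negP => /Spos; rewrite u0 ltxx. Qed.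

Lemma posdef_unit : S \in unitmx.
Proof. by apply: unitmx_ker => v v0; apply: posdef_eq0;
  rewrite /sdot -mulmxA v0 mulmx0 mxE. Qed.

(** The form is nonnegative at the vector obtained from u by subtracting its
    projection on v, scaled by the value of the form at v. *)
Lemma sdot_CS u v : sdot S u v ^+ 2 <= sdot S u u * sdot S v v.
Proof.
have [->|v0] := eqVneq v 0; first by rewrite !sdot0r expr0n mulr0.
have vv := Spos v0.
have := posdef_ge0 (sdot S v v *: u - sdot S u v *: v).
rewrite !(sdotDl, sdotDr, sdotNl, sdotNr, sdotZl, sdotZr) (sdot_sym ST v u).
set a := sdot S u u; set b := sdot S u v; set c := sdot S v v in vv *.
move=> h; have {h} : 0 <= c * (a * c - b ^+ 2) by move: h; congr (_ <= _); ring.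
by rewrite pmulr_rge0 // subr_ge0.
Qed.

(** Each coordinate of u is the pairing of u with a vector of the dual basis,
    hence bounded by the form through Cauchy-Schwarz. *)
Lemma posdef_coercive : exists2 a : R, 0 < a & forall u : 'cV[R]_n,
  a * \sum_i u i 0 ^+ 2 <= sdot S u u.
Proof.
pose b i : 'cV[R]_n := invmx S *m delta_mx i 0.
have bE i (u : 'cV[R]_n) : sdot S (b i) u = u i 0.
  rewrite /sdot trmx_mul trmx_inv ST mulmxKV ?posdef_unit // trmx_delta -rowE
    mxE //.
pose K := 1 + \sum_i sdot S (b i) (b i).
have K0 : 0 < K by rewrite ltr_pwDl // sumr_ge0 // => i _; apply: posdef_ge0.
exists K^-1; first by rewrite invr_gt0.
move=> u; rewrite mulrC ler_pdivrMr // mulrC.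
apply: (@le_trans _ _ ((\sum_i sdot S (b i) (b i)) * sdot S u u)).
  rewrite mulr_suml; apply: ler_sum => i _.
  by rewrite -{1}(bE i u); apply: sdot_CS.
by rewrite ler_wpM2r ?posdef_ge0 // lerDr.
Qed.

End PositiveForm.

(** * The Gram matrix *)

Section Form.
Variables (R : realType) (n : nat) (rho : {dot 'cV[R]_n for idfun}).

Definition gram : 'M[R]_n := \matrix_(i, k) rho (delta_mx i 0) (delta_mx k 0).

Lemma sum_deltaE (F : pzRingType) (u : 'cV[F]_n) : u = \sum_i u i 0 *:
  delta_mx i 0.
Proof. by rewrite [LHS]matrix_sum_delta; apply: eq_bigr => i _;
  rewrite big_ord1. Qed.

Lemma rho_sym u v : rho u v = rho v u.
Proof. by rewrite hermC /= mul1r. Qed.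

Lemma rhoE u v : rho u v = sdot gram u v.
Proof.
rewrite {1}(sum_deltaE u) {1}(sum_deltaE v) rho_sym linear_sum.
rewrite /sdot -mulmxA mxE; apply: eq_bigr => i _ /=.
rewrite linearZ /= rho_sym linear_sum !mxE; congr (_ * _);
  apply: eq_bigr => k _ /=.
by rewrite linearZ /= !mxE mulrC.
Qed.

Lemma gram_sym : gram^T = gram.
Proof. by apply/matrixP => i k; rewrite !mxE rho_sym. Qed.

Lemma gram_pos : posdef gram.
Proof. by move=> u u0; rewrite -rhoE; apply: neq0_dnorm_gt0. Qed.

Lemma gram_unit : gram \in unitmx.
Proof. exact: posdef_unit gram_pos. Qed.

Lemma sdot_toC (S : 'M[R]_n) u v : sdot (toC S) (toC u) (toC v) = real_complex
  R (sdot S u v).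
Proof.
by rewrite /sdot toC_tr -!toCM toCE [LHS]mxE.
Qed.

Lemma rhoCE u v : rhoC rho u v = sdot (toC gram) u v.
Proof.
rewrite [in RHS](mkCP u) [in RHS](mkCP v) !(sdotDl, sdotDr, sdotZl,
  sdotZr) !sdot_toC.
by apply: Cx_eq; rewrite ?(ReD, ImD, ReM, ImM)/= !rhoE; ring.
Qed.

Lemma adjoint_ofE A B : adjoint_of rho A B <-> A^T *m gram = gram *m B.
Proof.
split=> [AB|AB u v]; last by rewrite !rhoE (sdot_adj AB).
apply/matrixP => i k.
have := AB (delta_mx i 0) (delta_mx k 0); rewrite !rhoE /sdot trmx_mul -!mulmxA.
by rewrite trmx_delta -!rowE !mulmxA -!colE !mxE.
Qed.

End Form.

(** * The exponential and the form on the tube domain *)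

Section Exponential.
Variable R : realType.
Implicit Types a b : Cx R.

(** This is exp (pi i a), the exponential in which theta series are written. *)
Definition ex a : Cx R := expC ((0 +i* pi)%C * a).

Lemma expC_D a b : expC (a + b) = expC a * expC b.
Proof.
apply: Cx_eq; rewrite ?(ReM, ImM) /= ?(ReD, ImD) expRD ?cosD ?sinD; ring.
Qed.

Lemma expC_0 : expC (0 : Cx R) = 1.
Proof. by apply: Cx_eq; rewrite /= expR0 ?cos0 ?sin0 ?mulr1 ?mulr0. Qed.

Lemma ex_D a b : ex (a + b) = ex a * ex b.
Proof. by rewrite /ex mulrDr expC_D. Qed.

Lemma ex_0 : ex 0 = 1.
Proof. by rewrite /ex mulr0 expC_0. Qed.

Lemma ex_mulN a : ex a * ex (- a) = 1.
Proof. by rewrite -ex_D subrr ex_0. Qed.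

Lemma ex_neq0 a : ex a != 0.
Proof. by apply/eqP => a0; have := ex_mulN a; rewrite a0 mul0r => /esym/eqP;
  rewrite oner_eq0. Qed.

Lemma norm_ex a : `|ex a| = real_complex R (expR (- pi * complex.Im a)).
Proof.
rewrite normc_def; congr (real_complex R _) => /=.
set x := complex.Re _; set y := complex.Im _.
have -> : x = - pi * complex.Im a by rewrite /x ReM /=; ring.
rewrite !exprMn -mulrDr cos2Dsin2 mulr1 sqrtr_sqr ger0_norm ?expR_ge0 //.
Qed.

Lemma sin_shift (k : int) (x : R) : sin x = 0 -> sin (x - k%:~R * pi) = 0.
Proof.
move=> x0; case: k => k; last rewrite NegzE;
  rewrite ?rmorphN /= ?mulNr ?opprK mulr_natl.
  elim: k => [|k IH]; first by rewrite mulr0n subr0.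
  apply/eqP; rewrite -oppr_eq0 -sinDpi mulrSr opprD. by rewrite (addrA x)
    addrNK IH.
by elim: (k.+1) => [|{}k IH]; rewrite ?mulr0n ?addr0 // mulrSr addrA sinDpi IH
  oppr0.
Qed.

(** The modulus shows that a is real; its distance to the integer below, which
    lies in [0, 1), is 0 because pi times it has vanishing sine. *)
Lemma ex_eq1_int a : ex (2 * a) = 1 -> exists k : int, a = k%:~R.
Proof.
have R2 : (2 : Cx R) = real_complex R 2 by rewrite rmorph_nat.
move=> a1; have Ima : complex.Im a = 0.
  have := norm_ex (2 * a); rewrite a1 normr1 => /(@complexI R)/esym.
  rewrite -(@expR0 R) => /expR_inj /eqP;
    rewrite mulf_eq0 oppr_eq0 gt_eqF ?pi_gt0 //= R2 ImM /= mul0r addr0.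
  by rewrite mulf_eq0 pnatr_eq0 /= => /eqP.
have Re1 : cos (pi * complex.Re a + pi * complex.Re a) = 1.
  have := congr1 (@complex.Re _) a1; rewrite /= R2 !(ReM, ImM)/= Ima.
  rewrite !(mulr0, mul0r, addr0, subr0, add0r) oppr0 expR0 mul1r => <-.
  by congr cos; ring.
have sin0 : sin (pi * complex.Re a) = 0.
  move: Re1; rewrite cosD -!expr2 cos2sin2 => h; apply/eqP.
  by rewrite -sqrf_eq0; apply/eqP; lra.
pose k := Num.floor (complex.Re a).
have /andP[k1 k2] : k%:~R <= complex.Re a < (k + 1)%:~R by exact: floor_itv.
exists k; apply: Cx_eq; last first.
  by rewrite Ima -(rmorph_int (real_complex R)).
rewrite -(rmorph_int (real_complex R)) /=.
apply/eqP; rewrite eq_le k1 andbT leNgt; apply/negP => k3.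
have := sin_shift k sin0; apply/eqP; rewrite gt_eqF //; apply: sin_gt0_pi.
have pi0 := pi_gt0 R; rewrite (mulrC _ pi) -mulrBr mulr_gt0 ?subr_gt0 //=.
by move: k2; rewrite rmorphD /= => k2; rewrite gtr_pMr // ltrBlDl.
Qed.

End Exponential.

Section Tube.
Variables (R : realType) (n m : nat).
Variables (rho : {dot 'cV[R]_n for idfun}).
Variables (psi : {linear 'cV[Cx R]_m -> 'M[Cx R]_n}).
Hypothesis psi_sym : forall x : 'cV[R]_m,
  exists2 A, Sym rho A & psi (toC x) = toC A.

Local Notation P := (gram rho).
Local Notation PC := (toC P).
Local Notation B := (sdot P).
Local Notation BC := (sdot PC).

Definition re_psi (x : 'cV[R]_m) : 'M[R]_n := reM (psi (toC x)).

Lemma psi_toC x : psi (toC x) = toC (re_psi x).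
Proof. by have [A _ E] := psi_sym x; rewrite /re_psi E reM_toC. Qed.

Lemma re_psi_linear : linear re_psi.
Proof.
move=> k x y; apply: (@toC_inj R).
by rewrite -psi_toC !(toCD, toCZ) linearD linearZ /= !psi_toC.
Qed.

Lemma re_psiD x y : re_psi (x + y) = re_psi x + re_psi y.
Proof. by rewrite -[x in LHS]scale1r re_psi_linear scale1r. Qed.

Lemma re_psiZ k x : re_psi (k *: x) = k *: re_psi x.
Proof.
have re_psi0 : re_psi 0 = 0 by apply: (addrI (re_psi 0));
  rewrite -re_psiD !addr0.
by rewrite -[k *: x]addr0 re_psi_linear re_psi0 addr0.
Qed.

Lemma re_psi_Sym x : Sym rho (re_psi x).
Proof. by have [A AS E] := psi_sym x; rewrite /re_psi E reM_toC. Qed.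

Lemma re_psi_adj x : (re_psi x)^T *m P = P *m re_psi x.
Proof. by apply/adjoint_ofE; apply: re_psi_Sym. Qed.

Lemma psiE z : psi z = mkC (re_psi (reM z)) (re_psi (imM z)).
Proof. by rewrite {1}(mkCP z) linearD linearZ /= !psi_toC mkCE. Qed.

Lemma PC_sym : PC^T = PC.
Proof. by rewrite toC_tr gram_sym. Qed.

Lemma PC_unit : PC \in unitmx.
Proof. by rewrite toC_unit gram_unit. Qed.

Lemma psi_adj z : (psi z)^T *m PC = PC *m psi z.
Proof.
rewrite psiE mkCE [(_ + _)^T]linearD /= [(_ *: _)^T]linearZ /= mulmxDl mulmxDr
  -scalemxAl -scalemxAr.
by rewrite !toC_tr -!toCM !re_psi_adj.
Qed.

Lemma sdot_psi z u v : BC (psi z *m u) v = BC u (psi z *m v).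
Proof. by apply: sdot_adj; apply: psi_adj. Qed.

Lemma re_psi_form_sym x : (P *m re_psi x)^T = P *m re_psi x.
Proof. by rewrite trmx_mul gram_sym re_psi_adj. Qed.

Lemma coneE x : cone rho psi x <-> posdef (P *m re_psi x).
Proof.
have E u : rhoC rho (psi (toC x) *m toC u) (toC u) = real_complex R (sdot (P
  *m re_psi x) u u).
  by rewrite rhoCE sdot_psi psi_toC -toCM sdot_toC /sdot !mulmxA.
by split=> xY u u0; move: (xY u u0); rewrite E ltcR.
Qed.

(** If psi z kills x + i y, pairing the real part of the equation with y and the
    imaginary part with x makes the self-adjoint real part of psi z cancel, and
    leaves the positive form of im z at x and at y. *)
Lemma psi_unit z : tube rho psi z -> psi z \in unitmx.
Proof.
move=> /coneE zY; apply: unitmx_ker => v; rewrite (mkCP v) psiE -mkCE mkCM.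
set x := reM v; set y := imM v; set A := re_psi _;
  set C := re_psi (imM z) in zY *.
have -> : (0 : 'cV[Cx R]_n) = mkC 0 0 by rewrite -(toC0 R).
move=> /mkC_inj[/eqP]; rewrite subr_eq0 => /eqP E1 /eqP;
  rewrite addrC addr_eq0 => /eqP E2.
have BA a b : B a (A *m b) = B b (A *m a).
  by rewrite -(sdot_adj (re_psi_adj _)) (sdot_sym (gram_sym _)).
have BCE a : B a (C *m a) = sdot (P *m C) a a by rewrite /sdot !mulmxA.
have h : sdot (P *m C) x x + sdot (P *m C) y y = 0.
  by rewrite -!BCE E2 -E1 sdotNr BA addNr.
have x0 := posdef_ge0 zY x; have y0 := posdef_ge0 zY y.
have -> : x = 0 by apply: (posdef_eq0 zY); lra.
have -> : y = 0 by apply: (posdef_eq0 zY); lra.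
by [].
Qed.

End Tube.

(** * Unconditional sums *)

Section UnconditionalSum.
Variables (R : realType) (I : choiceType).

Local Notation psum := summability.partial_sum.
Local Notation tot := summability.totally.
#[local] Existing Instance summability.totally_filter.

Lemma totally_above (A0 : {fset I}) (Q : set {fset I}) :
  (forall A : {fset I}, (A0 `<=` A)%fset -> Q A) -> \forall A \near tot, Q A.
Proof. by move=> AQ; exists A0. Qed.

Lemma psumE (V : zmodType) (f : I -> V) A : psum f A = \sum_(i <- A) f i.
Proof. by rewrite /summability.partial_sum (big_seq_fsetE _ _ predT). Qed.

Lemma psum_le (g : I -> R) (A A' : {fset I}) : (forall i, 0 <= g i) ->
  (A `<=` A')%fset -> psum g A <= psum g A'.
Proof.
move=> g0 AA'; rewrite !psumE (big_fsetID _ (mem A) A') /=.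
rewrite [X in _ <= X + _](_ : _ = \sum_(i <- A) g i).
  by rewrite lerDl sumr_ge0.
apply: eq_fbigl => i; rewrite !inE /=; apply/andP/idP => [[]//|iA].
by split=> //; apply: (fsubsetP AA').
Qed.

Lemma psum_ge0_cvg (g : I -> R) (M : R) : (forall i, 0 <= g i) ->
  (forall A, psum g A <= M) -> cvg (psum g A @[A --> tot]).
Proof.
move=> g0 gM; pose S := [set psum g A | A in [set: {fset I}]].
have S_sup : has_sup S.
  split; first by exists (psum g fset0); exists fset0.
  by exists M => _ [A _ <-].
apply/cvg_ex; exists (sup S); apply/cvgrPdist_le => eps eps0.
have [_ [A0 _ <-] A0S] := sup_adherent eps0 S_sup.
apply: (@totally_above A0) => A A0A /=.
have le1 : psum g A <= sup S by apply: sup_upper_bound => //; exists A.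
have le2 := psum_le g0 A0A.
by rewrite ger0_norm ?subr_ge0 // lerBlDl -lerBlDr (le_trans (ltW A0S)).
Qed.

(** A dominated family is the difference of two nonnegative ones. *)
Lemma psum_real_cvg (a g : I -> R) (M : R) : (forall i, `|a i| <= g i) ->
  (forall A, psum g A <= M) -> cvg (psum a A @[A --> tot]).
Proof.
move=> ag gM; have g0 i : 0 <= g i by apply: le_trans (ag i).
have -> : psum a = psum (fun i => a i + g i) - psum g.
  by apply/funext => A; rewrite -[RHS]/(psum _ A - psum _ A) !psumE big_split
    /= addrK.
apply: is_cvgB; last exact: psum_ge0_cvg gM.
apply: (@psum_ge0_cvg _ (M + M)) => [i|A].
  by move: (ag i); rewrite ler_norml -lerBlDr sub0r => /andP[].
apply: le_trans (lerD (gM A) (gM A)); rewrite !psumE -big_split /=.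
by apply: ler_sum => i _; rewrite lerD2r (le_trans (ler_norm _)).
Qed.

Lemma Cx_norm_le (x : Cx R) :
  `|x| <= real_complex R (`|complex.Re x| + `|complex.Im x|).
Proof.
rewrite {1}(complexE x); apply: le_trans (ler_normD _ _) _.
rewrite normrM rmorphD /=; apply: lerD; rewrite ?normc_def /=.
  by rewrite lecR expr0n addr0 sqrtr_sqr.
rewrite -[X in X <= _](rmorphM (real_complex R)) lecR.
by rewrite !expr0n expr1n add0r addr0 sqrtr1 mul1r sqrtr_sqr.
Qed.

Lemma norm_Re_le (x : Cx R) (r : R) : `|x| <= real_complex R r ->
  `|complex.Re x| <= r.
Proof.
rewrite normc_def lecR; apply: le_trans.
by rewrite -sqrtr_sqr ler_sqrt ?lerDl ?sqr_ge0 // addr_ge0 ?sqr_ge0.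
Qed.

Lemma norm_Im_le (x : Cx R) (r : R) : `|x| <= real_complex R r ->
  `|complex.Im x| <= r.
Proof.
rewrite normc_def lecR; apply: le_trans.
by rewrite -sqrtr_sqr ler_sqrt ?lerDr ?sqr_ge0 // addr_ge0 ?sqr_ge0.
Qed.

Lemma psum_Cx_cvg (f : I -> Cx R) (g : I -> R) (M : R) :
  (forall i, `|f i| <= real_complex R (g i)) ->
  (forall A, psum g A <= M) ->
  exists l : Cx R, psum f A @[A --> tot] --> l.
Proof.
move=> fg gM.
have /cvg_ex[/= x xP] := psum_real_cvg (fun i => norm_Re_le (fg i)) gM.
have /cvg_ex[/= y yP] := psum_real_cvg (fun i => norm_Im_le (fg i)) gM.
pose l : Cx R := (x +i* y)%C; exists l.
apply/(@cvgrPdist_le (Cx R) (Cx R)) => eps eps0.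
have [d d0 dE] : exists2 d : R, 0 < d & real_complex R (d + d) = eps.
  case: eps eps0 => a b; rewrite ltcE /= => /andP[/eqP -> a0].
  by exists (a / 2); [rewrite divr_gt0|rewrite -splitr].
move/cvgrPdist_le: xP => /(_ _ d0) xP; move/cvgrPdist_le: yP => /(_ _ d0) yP.
apply: filterS2 xP yP => A xA yA.
rewrite -dE; apply: le_trans (Cx_norm_le _) _; rewrite lecR.
rewrite ReD ImD ReN ImN; apply: lerD.
  move: xA; congr (`|_ - _| <= _); rewrite !psumE.
  by elim/big_rec2: _ => // i a b _ ->; rewrite ReD.
move: yA; congr (`|_ - _| <= _); rewrite !psumE.
by elim/big_rec2: _ => // i a b _ ->; rewrite ImD.
Qed.

(** Domination makes the real and imaginary parts absolutely convergent, so the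
    sum is a genuine limit; it inherits the estimate that holds for all the
    partial sums containing i0. *)
Lemma sum_near_term (f : I -> Cx R) (g : I -> R) (i0 : I) (eps : R) :
  (forall i, `|f i| <= real_complex R (g i)) ->
  (forall A : {fset I}, i0 \notin A -> \sum_(i <- A) g i <= eps) ->
  `|summability.sum f - f i0| <= real_complex R eps.
Proof.
move=> fg geps; have g0 i : 0 <= g i by rewrite -ler0c; apply: le_trans (fg i).
have gM A : psum g A <= g i0 + eps.
  apply: le_trans (_ : psum g (i0 |` A)%fset <= _);
    first by rewrite psum_le // fsubsetUr.
  rewrite psumE (big_fsetD1 i0) ?fset1U1 //= lerD2l geps //.
  by rewrite !inE eqxx.
have [l f_cvg] := psum_Cx_cvg fg gM.
have -> : summability.sum f = l by apply: cvg_lim => //; apply: norm_hausdorff.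
apply/ler_addgt0Pr => d d0.
move/(@cvgrPdist_le (Cx R) (Cx R)): (f_cvg) => /(_ _ d0) hd.
have hA : \forall A \near tot, `|psum f A - f i0| <= real_complex R eps.
  apply: (@totally_above [fset i0]%fset) => A; rewrite fsub1set => i0A.
  rewrite psumE (big_fsetD1 i0) //= addrAC subrr add0r.
  apply: le_trans (ler_norm_sum _ _ _) _.
  apply: le_trans (_ : \sum_(i <- (A `\ i0)%fset) real_complex R (g i) <= _).
    by apply: ler_sum => i _; apply: fg.
  by rewrite -rmorph_sum lecR geps // !inE eqxx.
have [A [A1 A2]] := filter_ex (filterI hd hA).
rewrite -(subrK (psum f A) l) -addrA addrC.
by apply: le_trans (ler_normD _ _) _; apply: lerD.
Qed.

End UnconditionalSum.

(** * The theta series on a large dual lattice *)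

Section IntegerSums.
Variable R : realType.

Lemma ler_sum_sub (T : eqType) (s t : seq T) (F : T -> R) :
  (forall x, 0 <= F x) -> uniq s -> {subset s <= t} ->
  \sum_(x <- s) F x <= \sum_(x <- t) F x.
Proof.
move=> F0; elim: s t => [|x s IH] t /=; first by rewrite big_nil sumr_ge0.
move=> /andP[xs us] st; have xt : x \in t by apply: st; rewrite inE eqxx.
rewrite (perm_big _ (perm_to_rem xt)) !big_cons lerD2l IH // => y ys.
have := st y; rewrite inE ys orbT (perm_mem (perm_to_rem xt)) inE => /(_ isT).
by case: eqP => // yx; rewrite -yx ys in xs.
Qed.

Lemma sum_geometric_le (q : R) (K : nat) : 0 <= q < 1 ->
  \sum_(i <- iota 0 K) q ^+ i <= (1 - q)^-1.
Proof.
move=> /andP[q0 q1]; rewrite -[X in iota 0 X]subn0 big_mkord -div1r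
  ler_pdivlMr ?subr_gt0 //.
by rewrite mulrC -opprB mulNr -subrX1 opprB gerBl exprn_ge0.
Qed.

Lemma sum_int_geometric_le (q : R) (s : seq int) : 0 <= q < 1 -> uniq s ->
  \sum_(x <- s) q ^+ `|x|%N <= (1 + q) / (1 - q).
Proof.
move=> q01 us; have /andP[q0 q1] := q01.
pose K := (\max_(x <- s) `|x|%N).+1.
pose t := [seq Posz i | i <- iota 0 K] ++ [seq Negz i | i <- iota 0 K].
apply: le_trans (_ : \sum_(x <- t) q ^+ `|x|%N <= _).
  apply: ler_sum_sub => // [x|x xs]; first exact: exprn_ge0.
  have xK : (`|x|%N < K)%N by rewrite ltnS;
    apply: (@leq_bigmax_seq _ _ xpredT (fun x : int => `|x|%N)).
  rewrite mem_cat; case: x xK {xs} => i iK.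
    by rewrite map_f // mem_iota.
  by rewrite [X in _ || X]map_f ?orbT // mem_iota /= (ltn_trans _ iK) /=.
rewrite big_cat !big_map mulrDl mul1r; apply: lerD;
  first exact: sum_geometric_le.
under eq_bigr => i _ do rewrite /= exprS.
by rewrite -mulr_sumr ler_wpM2l // sum_geometric_le.
Qed.

(** The coordinates of the vectors in A range over a finite set s; extending the
    sum to all vectors with coordinates in s turns it into a product of sums. *)
Lemma sum_prod_le n (g : int -> R) (G : R) (A : seq 'cV[int]_n) :
  (forall x, 0 <= g x) -> (forall s, uniq s -> \sum_(x <- s) g x <= G) ->
  uniq A -> \sum_(k <- A) \prod_i g (k i 0) <= G ^+ n.
Proof.
move=> g0 gG uA.
pose s := undup [seq (k : 'cV[int]_n) i 0 | k <- A, i <- enum 'I_n].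
pose h (phi : {ffun 'I_n -> seq_sub s}) : 'cV[int]_n := \col_i val (phi i).
apply: le_trans (_ : \sum_(k <- [seq h phi | phi <- enum {ffun 'I_n ->
  seq_sub s}]) \prod_i g (k i 0) <= _).
  apply: ler_sum_sub => // [k|k kA]; first by rewrite prodr_ge0.
  have ks i : k i 0 \in s.
    by rewrite mem_undup; apply/allpairsP; exists (k, i); rewrite /= mem_enum.
  apply/mapP; exists [ffun i => SeqSub (ks i)]; first by rewrite mem_enum.
  by apply/matrixP => i u; rewrite ord1 !mxE ffunE.
rewrite big_map big_enum /=.
under eq_bigr => phi _ do under eq_bigr => i _ do rewrite mxE.
rewrite -(bigA_distr_bigA (fun i (x : seq_sub s) => g (val x))) /=.
rewrite -[X in _ ^+ X](card_ord n) -prodr_const; apply: ler_prod => i _.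
rewrite sumr_ge0 //= -(big_map val xpredT); apply: gG.
by rewrite map_inj_uniq ?index_enum_uniq //; apply: val_inj.
Qed.

End IntegerSums.

Section Lattice.
Variables (R : realType) (n m : nat).
Variables (rho : {dot 'cV[R]_n for idfun}).
Variables (psi : {linear 'cV[Cx R]_m -> 'M[Cx R]_n}).
Hypothesis psi_sym : forall x : 'cV[R]_m,
  exists2 A, Sym rho A & psi (toC x) = toC A.

Local Notation P := (gram rho).

Definition lat (C : 'M[R]_n) : set 'cV[R]_n :=
  [set C *m map_mx intr k | k in [set: 'cV[int]_n]].

Lemma lat0 C : lat C 0.
Proof. by exists 0 => //; rewrite map_mx0 mulmx0. Qed.

(** Rounding makes coords total; on the lattice it is exact. *)
Definition coords (C : 'M[R]_n) (l : 'cV[R]_n) : 'cV[int]_n :=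
  map_mx Num.floor (invmx C *m l).

Lemma coordsK C k : C \in unitmx -> coords C (C *m map_mx intr k) = k.
Proof.
move=> UC; rewrite /coords mulKmx //; apply/matrixP => i j.
by rewrite !mxE intrKfloor.
Qed.

Lemma lat_coords C l : C \in unitmx -> lat C l ->
  l = C *m map_mx intr (coords C l).
Proof. by move=> UC [k _ <-]; rewrite coordsK. Qed.

(** Together with the term 1 at the origin, the sum is at most the n-th power of
    a bilateral geometric series. *)
Lemma sum_lat_le C (q eps : R) (A : {fset 'cV[R]_n}) : C \in unitmx ->
  0 <= q < 1 -> ((1 + q) / (1 - q)) ^+ n <= 1 + eps -> 0 \notin A ->
  \sum_(l <- A) (if l \in lat C then \prod_i q ^+ `|coords C l i 0%R|%N else
    0) <= eps.
Proof.
move=> UC q01 qeps A0; have /andP[q0 _] := q01.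
rewrite -big_mkcond /= -big_filter.
set s := [seq l <- A | l \in lat C].
have us : uniq (0 :: s).
  by rewrite /= mem_filter (negPf A0) andbF filter_uniq ?fset_uniq.
have sC l : l \in 0 :: s -> lat C l.
  rewrite inE => /orP[/eqP ->|]; first exact: lat0.
  by rewrite mem_filter => /andP[/set_mem].
have : \sum_(k <- map (coords C) (0 :: s)) \prod_i q ^+ `|k i 0%R|%N <= ((1 +
  q) / (1 - q)) ^+ n.
  apply: (@sum_prod_le _ _ (fun x : int => q ^+ `|x|%N)) => [x|t ut|];
    first exact: exprn_ge0.
    exact: sum_int_geometric_le.
  rewrite map_inj_in_uniq // => x y xs ys xy.
  by rewrite (lat_coords UC (sC _ xs)) xy -lat_coords //; apply: sC.
rewrite big_map big_cons big1 => [|i _].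
  by move=> h; rewrite -(lerD2l 1); apply: le_trans h _.
by rewrite mxE mulmx0 mxE floor0 expr0.
Qed.

(** The exponent has a quadratic part of order N ^ 2 and a linear part of order
    N. Integers satisfy `|k| <= k ^ 2, so the quadratic part dominates a
    multiple of N ^ 2 times the l1 norm of k, and absorbs the linear one for
    large N. *)
Lemma norm_ex_lat_le (z : 'cV[Cx R]_m) (u : 'cV[Cx R]_n) (C : 'M[R]_n) :
  tube rho psi z -> C \in unitmx ->
  exists a : R, forall N : nat, a <= N%:R -> forall (k : 'cV[int]_n) l,
  l = (N%:R *: C) *m map_mx intr k ->
  `|ex (rhoC rho (psi z *m toC l + 2 *: u) (toC l))| <=
    real_complex R (\prod_i expR (- N%:R) ^+ `|k i 0%R|%N).
Proof.
move=> /(coneE psi_sym) zY UC.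
pose S := C^T *m (P *m re_psi psi (imM z)) *m C.
have SE x : sdot S x x = sdot (P *m re_psi psi (imM z)) (C *m x) (C *m x).
  by rewrite /sdot /S trmx_mul !mulmxA.
have S_sym : S^T = S by rewrite /S trmx_mul (trmx_mul C^T) trmxK
  (re_psi_form_sym psi_sym) !mulmxA.
have S_pos : posdef S.
  move=> x x0; rewrite SE; apply: zY; apply: contra_neq x0 => Cx0.
  by rewrite -(mulKmx UC x) Cx0 mulmx0.
have [a a0 aS] := posdef_coercive S_sym S_pos.
pose v := (imM u)^T *m P *m C.
pose K := \sum_i `|v 0 i|.
have vK i : `|v 0 i| <= K by rewrite /K (bigD1 i) //= lerDl sumr_ge0.
exists ((1 + 2 * K) / a) => N; rewrite ler_pdivrMr // => aN k l lk.
pose x : 'cV[R]_n := map_mx intr k.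
pose s := \sum_i `|x i 0|.
have s0 : 0 <= s by rewrite sumr_ge0.
have lE : l = N%:R *: (C *m x) by rewrite lk -scalemxAl.
have ImE : complex.Im (rhoC rho (psi z *m toC l + 2 *: u) (toC l)) =
    N%:R ^+ 2 * sdot S x x + 2 * N%:R * (v *m x) 0 0.
  rewrite rhoCE sdotDl sdotZl sdot_psi // (psiE psi_sym) mkCE mulmxDl
    -scalemxAl -!toCM.
  rewrite (mkCP u) !(sdotDl, sdotDr, sdotZl, sdotZr, sdot_toC).
  rewrite -(rmorph_nat (real_complex R)) !(ImD, ReD, ImM, ReM) /=.
  rewrite SE lE -!scalemxAr !(sdotZl, sdotZr) /sdot /v !mulmxA; ring.
have Sx : a * s <= sdot S x x.
  apply: le_trans (aS x); rewrite ler_pM2l //; apply: ler_sum => i _.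
  rewrite mxE -intr_norm -(rmorphXn _ 2) ler_int; nia.
have vx : - (K * s) <= (v *m x) 0 0.
  rewrite lerNl; apply: le_trans (ler_norm _) _.
  rewrite normrN mxE mulr_sumr; apply: le_trans (ler_norm_sum _ _ _) _.
  by apply: ler_sum => i _; rewrite normrM ler_wpM2r.
rewrite norm_ex lecR.
have -> : \prod_i expR (- N%:R) ^+ `|k i 0%R|%N = expR (- N%:R * s).
  rewrite mulr_sumr expR_sum; apply: eq_bigr => i _.
  rewrite -expRM_natl mulrC; congr (expR (_ * _)).
  by rewrite mxE -intr_norm -abszE.
rewrite ler_expR ImE !mulNr lerN2.
have N0 : 0 <= N%:R :> R by [].
apply: le_trans (_ : 1 * (N%:R * s) <= _); first by rewrite mul1r.
apply: ler_pM => //; first exact: mulr_ge0.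
  by have := pi_ge2 R; lra.
have -> : N%:R ^+ 2 * sdot S x x + 2 * N%:R * (v *m x) 0 0 =
  N%:R * (N%:R * sdot S x x + 2 * (v *m x) 0 0) by ring.
apply: ler_wpM2l => //.
apply: le_trans (_ : (N%:R * a - 2 * K) * s <= _).
  by rewrite -{1}[s]mul1r ler_wpM2r // lerBrDr.
rewrite mulrBl -!mulrA lerD // ?ler_wpM2l //. rewrite -mulrN ler_wpM2l //.
Qed.

(** Scaling up the dual lattice pushes all its points but the origin to
    infinity, where the terms of the series decay like Gaussians. *)
Lemma theta_near1 (z : 'cV[Cx R]_m) (u : 'cV[Cx R]_n) (C : 'M[R]_n) (eps : R) :
  tube rho psi z -> C \in unitmx -> 0 < eps ->
  \forall N \near \oo, forall L, dual_lattice rho L = lat (N%:R *: C) ->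
    `|theta rho psi L z u - 1| <= real_complex R eps.
Proof.
move=> zY UC eps0.
have [a aP] := norm_ex_lat_le u zY UC.
have q1 N : (0 < N)%N -> 0 <= (expR (- N%:R) : R) < 1.
  by move=> N0; rewrite expR_ge0 expR_lt1 oppr_lt0 ltr0n.
have qN := @cvgn_expR R.
have cvg0 : ((1 + expR (- N%:R)) / (1 - expR (- N%:R)) : R) @[N --> \oo] -->
    ((1 + 0) / (1 - 0) : R).
  apply: cvgM; first by apply: cvgD => //; apply: cvg_cst.
  apply: cvgV; first by rewrite subr0 oner_eq0.
  by apply: cvgB => //; apply: cvg_cst.
have cvg1 := cvg_comp _ _ cvg0 (@exprn_continuous R n _).
rewrite addr0 subr0 divr1 expr1n in cvg1.
move/cvgrPdist_le: cvg1 => /(_ _ eps0) cvg1.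
near=> N => L LE.
have N0 : (0 < N)%N by near: N; exists 1%N.
have UNC : N%:R *: C \in unitmx by rewrite unitmxZ // unitfE pnatr_eq0 -lt0n.
have aN : a <= N%:R by near: N; apply: nbhs_infty_ger.
pose g l := if l \in lat (N%:R *: C) then
  \prod_i (expR (- N%:R) : R) ^+ `|coords (N%:R *: C) l i 0%R|%N else 0.
rewrite /theta LE.
have := @sum_near_term R _ (fun l : 'cV[R]_n =>
    if l \in lat (N%:R *: C) then
      expC ((0 +i* pi)%C * rhoC rho (psi z *m toC l + 2 *: u) (toC l)) : Cx R
    else 0) g 0 eps.
rewrite ifT; last by apply/mem_set/lat0.
rewrite [X in expC X](_ : _ = 0); last by rewrite toC0 rhoCE sdot0r mulr0.
rewrite expC_0; apply=> [l|A A0].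
  rewrite /g; case: ifPn => [/set_mem lN|_]; last by rewrite normr0.
  by apply: aP => //; apply: lat_coords.
apply: sum_lat_le => //; first exact: q1.
rewrite -lerBlDl; apply: le_trans (ler_norm _) _; rewrite distrC.
by near: N.
Unshelve. all: by end_near. Qed.

End Lattice.

(** * Lattices and their duals *)

Section DualLattice.
Variables (R : realType) (n : nat) (rho : {dot 'cV[R]_n for idfun}).
Local Notation P := (gram rho).

(** The columns of this matrix are the dual basis, for rho, of those of B. *)
Definition dualb (B : 'M[R]_n) : 'M[R]_n := invmx (B^T *m P).

Lemma dualb_unit B : B \in unitmx -> dualb B \in unitmx.
Proof. by move=> UB; rewrite unitmx_inv unitmx_mul unitmx_tr UB gram_unit. Qed.

Lemma dualbK B : B \in unitmx -> dualb (dualb B) = B.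
Proof.
move=> UB; have UP := gram_unit rho.
apply: (can_inj (@invmxK _ _));
  rewrite /dualb invmxK trmx_inv trmx_mul trmxK gram_sym.
apply: (can_inj (mulmxK UB)); rewrite mulVmx // -mulmxA mulVmx //.
by rewrite unitmx_mul UP.
Qed.

Lemma dualbZ k B : k != 0 -> B \in unitmx -> dualb (k *: B) = k^-1 *: dualb B.
Proof.
move=> k0 UB; rewrite /dualb linearZ /= -scalemxAl invmxZ //.
by rewrite unitmxZ ?unitfE // unitmx_mul unitmx_tr UB gram_unit.
Qed.

Lemma rho_dualb B x y : B \in unitmx ->
  rho (B *m x) (dualb B *m y) = (x^T *m y) 0 0.
Proof.
move=> UB; rewrite rhoE /sdot trmx_mul -!mulmxA (mulmxA B^T) (mulmxA _ (dualb
  B)).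
by rewrite mulmxV ?mul1mx // unitmx_mul unitmx_tr UB gram_unit.
Qed.

Lemma lat_full (C : 'M[R]_n) : C \in unitmx -> full_lattice (lat C).
Proof. by exists C. Qed.

Lemma dual_lat B : B \in unitmx -> dual_lattice rho (lat B) = lat (dualb B).
Proof.
move=> UB; apply/seteqP; split=> [x xB|_ [k _ <-] _ [k' _ <-]]; last first.
  rewrite rho_dualb // mxE rpred_sum // => i _.
  by rewrite !mxE rpredM // intr_int.
have [y xE] : exists y, x = dualb B *m y.
  by exists (invmx (dualb B) *m x); rewrite mulKVmx ?dualb_unit.
have yint i : y i 0 \is a Num.int.
  have /xB : lat B (B *m map_mx intr (delta_mx i 0)) by exists (delta_mx i 0).
  by rewrite xE rho_dualb // map_delta_mx trmx_delta -rowE mxE.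
exists (map_mx Num.floor y) => //; rewrite xE; congr (_ *m _).
by apply/matrixP => i k; rewrite ord1 !mxE floorK.
Qed.

Lemma dual_lat_dualb B : B \in unitmx ->
  dual_lattice rho (lat (dualb B)) = lat B.
Proof. by move=> UB; rewrite dual_lat ?dualb_unit // dualbK. Qed.

Lemma lat_scale (N : nat) (C : 'M[R]_n) l : lat C l -> lat C (N%:R *: l).
Proof.
move=> [k _ <-]; exists (N%:Z *: k) => //.
by rewrite map_mxZ -scalemxAr; congr (_ *: _).
Qed.

Lemma latZ (a : R) (C : 'M[R]_n) l : lat C l -> lat (a *: C) (a *: l).
Proof. by move=> [k _ <-]; exists k => //; rewrite scalemxAl. Qed.

Lemma lat_refine (N : nat) (C : 'M[R]_n) l : (0 < N)%N ->
  lat C l -> lat (N%:R^-1 *: C) l.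
Proof.
move=> N0 /(lat_scale N)/(latZ N%:R^-1).
by rewrite scalerA mulVf ?scale1r // pnatr_eq0 -lt0n.
Qed.

(** Gaussian elimination applied to the row l^T writes it as a multiple of the
    first row of an invertible matrix. *)
Lemma lat_through (l : 'cV[R]_n) : exists2 C, C \in unitmx & lat C l.
Proof.
pose r := \rank l^T; pose a := col_ebase l^T 0 0.
have a0 : a != 0.
  have := col_ebase_unit l^T; rewrite unitmxE det_mx11 unitfE //.
exists (a *: (row_ebase l^T)^T).
  by rewrite unitmxZ ?unitfE // unitmx_tr row_ebase_unit.
exists (pid_mx r)^T => //; apply: trmx_inj.
rewrite -[in RHS](mulmx_ebase l^T) [col_ebase _]mx11_scalar -/a.
rewrite trmx_mul linearZ /= trmxK map_trmx trmxK map_pid_mx.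
by rewrite mul_scalar_mx -scalemxAl -scalemxAr.
Qed.

End DualLattice.

Section Limits.
Variable R : realType.

(** This removes the lattice from an identity in which it only appears through
    theta series that tend to 1. *)
Lemma eq_of_near1 (a b : Cx R) :
  (forall eps : R, 0 < eps -> exists x y : Cx R,
    [/\ `|x - 1| <= real_complex R eps,
      `|y - 1| <= real_complex R eps & a * x = b * y]) ->
  a = b.
Proof.
move=> ab; apply/eqP; rewrite -subr_eq0 -normr_le0; apply/ler_addgt0Pr => d d0.
have [k k0 kE] : exists2 k : R, 0 <= k & `|a| + `|b| = real_complex R k.
  exists (complex.Re (`|a| + `|b|)); rewrite !normc_def /=.
    by rewrite addr_ge0 ?sqrtr_ge0.
  by rewrite -rmorphD.
have [e e0 ed] : exists2 e : R, 0 < e & real_complex R (e * (k + 1)) = d.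
  case: d d0 => d d'; rewrite ltcE /= => /andP[/eqP -> dd].
  have k1 : 0 < k + 1 by rewrite ltr_wpDl.
  by exists (d / (k + 1)); [rewrite divr_gt0|rewrite divfK ?gt_eqF].
have [x [y [x1 y1 xy]]] := ab _ e0.
have -> : a - b = b * (y - 1) - a * (x - 1).
  by rewrite !mulrBr xy !mulr1; ring.
apply: le_trans (ler_normB _ _) _; rewrite !normrM add0r -ed.
apply: le_trans (_ : (`|a| + `|b|) * real_complex R e <= _).
  by rewrite mulrDl addrC lerD // ler_wpM2l.
by rewrite kE -rmorphM lecR mulrC ler_wpM2l ?(ltW e0) // lerDl.
Qed.

Lemma neq0_of_near1 (x : Cx R) : `|x - 1| <= real_complex R (1 / 2) -> x != 0.
Proof.
move=> x1; apply/eqP => x0; move: x1; rewrite x0 sub0r normrN normr1.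
by rewrite -[1](rmorph1 (real_complex R)) lecR; lra.
Qed.

Lemma norm_intr (k : int) : k != 0 -> 1 <= `|k%:~R : Cx R|.
Proof. by move=> k0; rewrite -intr_norm ler1z; lia. Qed.

(** A nonzero a has a real multiple of modulus 1/2. *)
Lemma eq0_of_int_multiples (a : Cx R) :
  (forall t : R, exists k : int, real_complex R t * a = k%:~R) -> a = 0.
Proof.
move=> ta; apply/eqP/negP => /negP a0.
pose r := complex.Re `|a|.
have rE : `|a| = real_complex R r by rewrite /r normc_def.
have r0 : 0 < r by rewrite -ltcR -rE normr_gt0.
have [k kE] := ta (r^-1 / 2).
have nk : `|k%:~R : Cx R| = real_complex R (1 / 2).
  rewrite -kE normrM rE normc_def /= expr0n addr0 sqrtr_sqr -rmorphM.
  rewrite ger0_norm; last by rewrite divr_ge0 // invr_ge0 ltW.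
  by rewrite mulrAC mulVf ?gt_eqF.
have [k0|/norm_intr] := eqVneq k 0.
  by move: nk; rewrite k0 normr0 => /(congr1 (@complex.Re _))/=; lra.
by rewrite nk -[1](rmorph1 (real_complex R)) lecR; lra.
Qed.

End Limits.

(** * Consequences of the transformation formula *)

Section Transformation.
Variables (R : realType) (n m : nat).
Variables (rho : {dot 'cV[R]_n for idfun}).
Variables (psi : {linear 'cV[Cx R]_m -> 'M[Cx R]_n}).
Hypothesis psi_sym : forall x : 'cV[R]_m,
  exists2 A, Sym rho A & psi (toC x) = toC A.
Hypothesis T2 : theta_T2 rho psi.
Variables (j : 'cV[Cx R]_m -> 'cV[Cx R]_m) (J : 'cV[Cx R]_m -> 'M[Cx R]_n).
Variables (H : 'cV[Cx R]_m * 'cV[Cx R]_n -> Cx R) (c : set 'cV[R]_n -> Cx R).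
Hypothesis j_tube : forall z, tube rho psi z -> tube rho psi (j z).
Hypothesis j_invol : forall z, tube rho psi z -> j (j z) = z.
Hypothesis H_neq0 : forall z u, tube rho psi z -> H (z, u) != 0.
Hypothesis T5 : theta_T5 rho psi j J H c.

Local Notation th := (theta rho psi).
Local Notation dual := (dual_lattice rho).
Local Notation D := (dualb rho).
Local Notation bc := (rhoC rho).

Lemma bcDl u v w : bc (u + v) w = bc u w + bc v w.
Proof. by rewrite !rhoCE sdotDl. Qed.

Lemma bcZl a u v : bc (a *: u) v = a * bc u v.
Proof. by rewrite !rhoCE sdotZl. Qed.

Lemma bcZr a u v : bc u (a *: v) = a * bc u v.
Proof. by rewrite !rhoCE sdotZr. Qed.

Lemma scaleN_unit (N : nat) (C : 'M[R]_n) : (0 < N)%N -> C \in unitmx ->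
  N%:R *: C \in unitmx.
Proof. by move=> N0 UC; rewrite unitmxZ // unitfE pnatr_eq0 -lt0n. Qed.

Lemma theta_shift L z u l : full_lattice L -> tube rho psi z -> dual L l ->
  ex (bc (psi z *m toC l + 2 *: u) (toC l)) * th L z (u + psi z *m toC l) = th
    L z u.
Proof.
move=> LL zT lL; rewrite (T2 LL) // mulrA mulNr -mulrN -/(ex _).
by rewrite ex_mulN mul1r.
Qed.

(** The lattice whose dual is N times lat C; for large N its theta series is
    close to 1. *)
Let coarse (N : nat) (C : 'M[R]_n) := lat (D (N%:R *: C)).

Lemma dual_coarse N C : (0 < N)%N -> C \in unitmx ->
  dual (coarse N C) = lat (N%:R *: C).
Proof. by move=> N0 UC; rewrite dual_lat_dualb // scaleN_unit. Qed.

Lemma coarse_full N C : (0 < N)%N -> C \in unitmx -> full_lattice (coarse N C).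
Proof. by move=> N0 UC; apply/lat_full/dualb_unit/scaleN_unit. Qed.

Lemma dual_dual_coarse N C : (0 < N)%N -> C \in unitmx ->
  dual (dual (coarse N C)) = coarse N C.
Proof. by move=> N0 UC; rewrite dual_coarse // dual_lat // scaleN_unit. Qed.

Lemma coarse_mem N C l : (0 < N)%N -> C \in unitmx -> lat (D C) l ->
  coarse N C l.
Proof.
move=> N0 UC lC; rewrite /coarse dualbZ // ?pnatr_eq0 -?lt0n //.
exact: lat_refine.
Qed.

(** Applying the formula twice recovers the series of the original lattice,
    which is nonzero once the dual lattice is large. *)
Lemma c_near_neq0 C z : C \in unitmx -> tube rho psi z ->
  \forall N \near \oo, c (coarse N C) != 0.
Proof.
move=> UC zT; near=> N.
have N0 : (0 < N)%N by near: N; exists 1%N.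
have near1 : `|th (coarse N C) z 0 - 1| <= real_complex R (1 / 2).
  move: (dual_coarse N0 UC); move: (coarse N C); near: N.
  by apply: theta_near1 => //; rewrite divr_gt0.
have fullL := coarse_full N0 UC.
have fullD : full_lattice (dual (coarse N C)).
  by rewrite dual_coarse //; apply/lat_full/scaleN_unit.
have wT := j_tube zT.
apply: contraTneq (neq0_of_near1 near1) => c0.
have := T5 fullD 0 wT.
rewrite dual_dual_coarse // j_invol // mulmx0 -[X in th _ (j z) X](mulmx0 _ (J
  z)) (T5 fullL) //.
by rewrite c0 !mul0r mulr0 => ->; rewrite eqxx.
Unshelve. all: by end_near. Qed.

(** Quasi-periodicity gives this up to a quotient of two values of the series on
    the other side of the formula. When the lattice through l gets finer, that
    series runs over a coarser one, and the quotient tends to 1. *)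
Lemma H_shift z u l : tube rho psi z ->
  H (z, u + psi z *m toC l) =
    H (z, u) * ex (bc (psi z *m toC l + 2 *: u) (toC l)).
Proof.
move=> zT; have [C UC lC] := lat_through l.
have wT := j_tube zT; set q := bc _ _.
have UD : D C \in unitmx by apply: dualb_unit.
apply: eq_of_near1 => eps eps0.
have near1 v := theta_near1 psi_sym v wT UD eps0.
have [N [[N0 x1] y1]] := filter_ex (filterI (filterI (nbhs_infty_gt 0)
  (near1 (J z *m (u + psi z *m toC l)))) (near1 (J z *m u))).
set L := lat (N%:R *: D C).
have LE : L = dual (coarse N (D C)) by rewrite dual_coarse.
have dLE : dual L = coarse N (D C) by rewrite LE dual_dual_coarse.
have fullL : full_lattice L by apply/lat_full/scaleN_unit.
have lL : dual L l by rewrite dLE; apply: coarse_mem; rewrite ?dualbK.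
have ddL : dual (dual L) = L by rewrite dLE -LE.
exists (th (dual L) (j z) (J z *m u)),
  (th (dual L) (j z) (J z *m (u + psi z *m toC l))).
split; [exact: y1|exact: x1|].
rewrite (T5 fullL u zT) (T5 fullL _ zT) -(theta_shift u fullL zT lL) -/q; ring.
Qed.

(** The same argument with the two sides exchanged: quasi-periodicity is used at
    j z, and the quotient of the values of the series at z tends to 1. *)
Lemma H_shift_J z u x l : tube rho psi z -> J z *m x = psi (j z) *m toC l ->
  H (z, u) =
    H (z, u + x) * ex (bc (psi (j z) *m toC l + 2 *: (J z *m u)) (toC l)).
Proof.
move=> zT xE; have [C UC lC] := lat_through l.
have wT := j_tube zT; set q := bc _ _.
have UD : D C \in unitmx by apply: dualb_unit.
apply: eq_of_near1 => eps eps0.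
have near1 v := theta_near1 psi_sym v zT UD eps0.
have [N [[[N0 x1] y1] cN]] := filter_ex (filterI (filterI (filterI
  (nbhs_infty_gt 0)
  (near1 (u + x))) (near1 u)) (c_near_neq0 UD zT)).
set L := coarse N (D C) in cN.
have dL : dual L = lat (N%:R *: D C) by rewrite dual_coarse.
have fullL : full_lattice L by exact: coarse_full.
have fullD : full_lattice (dual L) by rewrite dL; apply/lat_full/scaleN_unit.
have lL : dual (dual L) l by rewrite dual_dual_coarse //; apply: coarse_mem;
  rewrite ?dualbK.
exists (th L z u), (th L z (u + x)); split; [exact: y1|exact: x1|].
have := theta_shift (J z *m u) fullD wT lL.
rewrite -/q -xE -mulmxDr (T5 fullL u zT) (T5 fullL (u + x) zT) => E.
move: (th L z u) (th L z (u + x)) (c L) cN (H (z, u)) (H (z, u + x)) (ex q) E.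
by move=> a b k k0 h h' e E; apply: (mulfI k0); rewrite mulrA -E; ring.
Qed.

(** The two kinds of shift commute, and the two orders differ by an exponential
    of a bilinear form in l and l'. So this form takes integer values at all
    real multiples of l', hence vanishes. *)
Lemma shift_commute z x l : tube rho psi z -> J z *m x = psi (j z) *m toC l ->
  forall l', bc x (toC l') = - bc (J z *m psi z *m toC l') (toC l).
Proof.
move=> zT xE l'; apply/eqP; rewrite -subr_eq0 opprK; apply/eqP.
apply: eq0_of_int_multiples => t.
suff /ex_eq1_int[k kE] : ex (2 * (bc x (toC (t *: l')) + bc (J z *m psi z *m
  toC (t *: l')) (toC l))) = 1.
  by exists k; rewrite -kE toCZ !linearZ /= !bcZl bcZr mulrDr.
move: (t *: l') => {t}l'.
have A0 := H_shift 0 l' zT; have Ax := H_shift x l' zT.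
have B0 := H_shift_J 0 zT xE; have BA := H_shift_J (psi z *m toC l') zT xE.
rewrite !add0r in A0 B0; rewrite addrC in Ax.
rewrite BA {BA} Ax {Ax} B0 {B0} in A0.
rewrite !bcDl !bcZl in A0.
rewrite mulmx0 !mulmxA in A0.
have b0 v : bc 0 v = 0 by rewrite rhoCE sdot0l.
rewrite !b0 !mulr0 !addr0 in A0.
set p := bc (psi z *m _) _ in A0; set r := bc (psi (j z) *m _) _ in A0.
rewrite mulrDr ex_D !ex_D in A0 *.
have nz : H (z, x) * (ex p * ex r) != 0 by rewrite !mulf_neq0 ?ex_neq0 ?H_neq0.
by apply: (mulfI nz); rewrite mulr1; move: A0; set h := H (z, x) => A0;
  ring: A0.
Qed.

(** In the case l = 0 of the previous lemma, a vector killed by J z is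
    orthogonal to all the real vectors. *)
Lemma J_inj z : tube rho psi z -> J z \in unitmx.
Proof.
move=> zT; apply: unitmx_ker => x Jx0.
apply: (@sdot_eqr _ _ (toC (gram rho))); first exact: PC_unit.
move=> i; rewrite sdot0l -rhoCE.
have -> : delta_mx i 0 = toC (delta_mx i 0) :> 'cV[Cx R]_n.
  by rewrite toCE map_delta_mx.
rewrite (@shift_commute z x 0) ?toC0 ?mulmx0 //.
by rewrite rhoCE sdot0r oppr0.
Qed.

(** By H_shift, the factor H in the formula has exactly the quasi-periodicity of
    the series at z, up to inversion. So translation by J z psi z l is a genuine
    period of the series at j z. A period commutes with a quasi-period psi (j z)
    l' only if their pairing is an integer. *)
Lemma period_int z C l l' : tube rho psi z -> C \in unitmx -> lat C l ->
  lat (D C) l' ->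
  exists k : int, bc (J z *m psi z *m toC l) (toC l') = k%:~R.
Proof.
move=> zT UC lC lD; have wT := j_tube zT.
have UD : D C \in unitmx by apply: dualb_unit.
have eps0 : 0 < (1 / 2 : R) by rewrite divr_gt0.
have [N [N0 near1]] := filter_ex (filterI (nbhs_infty_gt 0)
  (theta_near1 psi_sym 0 wT UD eps0)).
have Nn0 : N%:R != 0 :> R by rewrite pnatr_eq0 -lt0n.
pose L := lat (N%:R *: D C).
have LE : L = dual (coarse N (D C)) by rewrite dual_coarse.
have dLE : dual L = coarse N (D C) by rewrite LE dual_dual_coarse.
have fullL : full_lattice L by apply/lat_full/scaleN_unit.
have fullD : full_lattice (dual L) by rewrite dLE; apply: coarse_full.
have ddL : dual (dual L) = L by rewrite dLE -LE.
have := neq0_of_near1 (near1 _ ddL); set G := th (dual L) (j z) => G0.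
pose l1 := N%:R^-1 *: l; pose l2 := N%:R *: l'.
have l1L : dual L l1.
  by rewrite dLE /coarse dualbZ // dualbK //; apply: latZ.
have l2L : dual (dual L) l2 by rewrite ddL; apply: latZ.
have Gper v : G (v + J z *m psi z *m toC l1) = G v.
  rewrite -(mulKVmx (J_inj zT) v); set u := invmx _ *m v.
  rewrite -mulmxA -mulmxDr /G (T5 fullL _ zT) (T5 fullL _ zT) (H_shift _ _ zT).
  by rewrite -[in RHS](theta_shift u fullL zT l1L); ring.
have Gshift v : ex (bc (psi (j z) *m toC l2 + 2 *: v) (toC l2)) * G (v + psi
  (j z) *m toC l2) = G v.
  exact: theta_shift.
have [k kE] : exists k : int, bc (J z *m psi z *m toC l1) (toC l2) = k%:~R.
  apply: ex_eq1_int.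
  (* The values of G at psi (j z) l2 and at its translate by s agree. *)
  clearbody G; set s := J z *m psi z *m toC l1 in Gper *.
  have := Gshift s; rewrite (addrC s) Gper bcDl bcZl ex_D.
  have -> : G s = G 0 by rewrite -(Gper 0) add0r.
  have := Gshift 0; rewrite add0r scaler0 addr0.
  move: (G _) (G 0) G0 (ex _) (ex _) => g g0 g0n a b E E'.
  by apply: (mulfI g0n); rewrite mulr1 -[RHS]E' -[in LHS]E; ring.
exists k; rewrite -kE /l1 /l2 !toCZ linearZ /= bcZl bcZr mulrA -rmorphM.
by rewrite mulVf // mul1r.
Qed.

End Transformation.

(** * The maps j and J *)

Section ScalarMatrix.
Variables (R : realType) (n : nat).

Lemma sdot_dualb_toC (rho : {dot 'cV[R]_n for idfun}) C (x y : 'cV[Cx R]_n) :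
  C \in unitmx -> sdot (toC (gram rho)) (toC C *m x) (toC (dualb rho C) *m y)
    = (x^T *m y) 0 0.
Proof.
move=> UC; rewrite /sdot trmx_mul -!mulmxA; congr ((x^T *m _) 0 0).
rewrite toC_tr !mulmxA -!toCM mulmxV ?toC1 ?mul1mx //.
by rewrite unitmx_mul unitmx_tr UC gram_unit.
Qed.

Lemma toC_delta p q (a : 'I_p) (b : 'I_q) : toC (delta_mx a b) = delta_mx a b
  :> 'M[Cx R]_(p, q).
Proof. by rewrite toCE map_delta_mx. Qed.

Lemma mulmx_deltaE (F : pzRingType) (X : 'M[F]_n) (a b i : 'I_n) : (X *m
  delta_mx a b) i b = X i a.
Proof.
rewrite mxE (bigD1 a) //= mxE !eqxx mulr1 big1 ?addr0 // => k ka.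
by rewrite mxE (negPf ka) mulr0.
Qed.

Lemma delta_mulmxE (F : pzRingType) (X : 'M[F]_n) (a b k : 'I_n) : (delta_mx a
  b *m X) a k = X b k.
Proof.
rewrite mxE (bigD1 b) //= mxE !eqxx mul1r big1 ?addr0 // => i ib.
by rewrite mxE (negPf ib) andbF mul0r.
Qed.

(** Conjugation by the elementary matrices 1 + t E_ab with real t turns the
    entry at a, b into a polynomial in t, which can only take integer values
    when it is constant. *)
Lemma integral_conjugates_scalar (X : 'M[Cx R]_n) : (0 < n)%N ->
  (forall C : 'M[R]_n, C \in unitmx -> forall a b, exists k : int,
    (invmx (toC C) *m X *m toC C) a b = k%:~R) ->
  exists k : int, X = (k%:~R)%:M.
Proof.
move=> n0 Xint.
have X1 a b : exists k : int, X a b = k%:~R.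
  by have := Xint 1%:M (unitmx1 _ _) a b; rewrite toC1 invmx1 mul1mx mulmx1.
have Xt a b (t : R) : a != b -> exists k : int,
    real_complex R t * (X a a - X b b) - real_complex R t ^+ 2 * X b a = k%:~R.
  move=> ab; pose E : 'M[R]_n := delta_mx a b; pose C := 1%:M + t *: E.
  have EE : E *m E = 0 by rewrite /E mul_delta_mx_0 // eq_sym.
  have CV : C *m (1%:M - t *: E) = 1%:M.
    rewrite /C mulmxBr mulmx1 mulmxDl mul1mx -scalemxAl -scalemxAr EE !scaler0
      addr0.
    by rewrite addrK.
  have [UC _] := mulmx1_unit CV.
  have iC : invmx C = 1%:M - t *: E by rewrite -[RHS](mulKmx UC) CV mulmx1.
  have [k] := Xint C UC a b; have [k' kE'] := X1 a b => kE.
  exists (k - k'); rewrite rmorphB /= -kE -kE' -toC_inv iC /C !toCD toCN !toCZ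
    toC1.
  rewrite toC_delta.
  rewrite mulmxDr mulmx1 -scalemxAr mulmxBl mul1mx -!scalemxAl mulmxBl
    -scalemxAl.
  have entD (A B : 'M[Cx R]_n) : (A + B) a b = A a b + B a b by rewrite mxE.
  have entN (A : 'M[Cx R]_n) : (- A) a b = - A a b by rewrite mxE.
  have entZ s (A : 'M[Cx R]_n) : (s *: A) a b = s * A a b by rewrite mxE.
  rewrite !(entD, entN, entZ) !mulmx_deltaE !delta_mulmxE; ring.
have lim0 (A B : Cx R) : (forall t : R, exists k : int,
    real_complex R t * A - real_complex R t ^+ 2 * B = k%:~R) -> A = 0 /\ B = 0.
  move=> AB; have A0 : A = 0.
    apply: eq0_of_int_multiples => t.
    have [k kE] := AB (t / 2); have [k' kE'] := AB (- (t / 2)).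
    exists (k - k'); rewrite rmorphB /= -kE -kE'.
    by rewrite [in LHS](splitr t) rmorphD rmorphN; ring.
  split=> //; apply: eq0_of_int_multiples => t.
  have [t0|t0] := leP 0 t.
    have [k kE] := AB (Num.sqrt t); exists (- k); rewrite rmorphN /= -kE A0.
    by rewrite -rmorphXn sqr_sqrtr //; ring.
  have [k kE] := AB (Num.sqrt (- t)); exists k; rewrite -kE A0.
  rewrite -rmorphXn sqr_sqrtr ?oppr_ge0 ?ltW // rmorphN; ring.
have Xdiag a b : a != b -> X a a = X b b /\ X b a = 0.
  move=> ab; have [/eqP] := lim0 _ _ (fun t => Xt a b t ab).
  by rewrite subr_eq0 => /eqP -> ->.
have [k kE] := X1 (Ordinal n0) (Ordinal n0); exists k.
apply/matrixP => a b; rewrite mxE; have [<-|ba] := eqVneq a b.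
  rewrite mulr1n -kE; have [<-//|a0] := eqVneq (Ordinal n0) a.
  by have [] := Xdiag _ _ a0.
by rewrite mulr0n; have [] := Xdiag b a; rewrite 1?eq_sym.
Qed.

End ScalarMatrix.

Lemma cvg_sum_mul_affine (K : numFieldType) (T : Type) (F : set_system T) (FF
  : Filter F) n
    (u : 'I_n -> T -> K) (l A B : 'I_n -> K) (q : T -> K) (lq : K) :
  (forall a, u a x @[x --> F] --> l a) -> q x @[x --> F] --> lq ->
  \sum_a u a x * (A a + q x * B a) @[x --> F] --> \sum_a l a * (A a + lq * B a).
Proof.
move=> ul ql; apply: cvg_big => [|a _]; first exact: add_continuous.
apply: cvgM; first exact: ul.
have h : (fun x => q x * B a) x @[x --> F] --> lq * B a.
  by apply: cvgM => //; apply: cvg_cst.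
exact: (cvgD (cvg_cst (A a)) h).
Qed.

Section Inversion.
Variables (R : realType) (n m : nat).
Hypothesis n_gt0 : (0 < n)%N.
Variables (rho : {dot 'cV[R]_n for idfun}).
Variables (psi : {linear 'cV[Cx R]_m -> 'M[Cx R]_n}).
Hypothesis psi_sym : forall x : 'cV[R]_m,
  exists2 A, Sym rho A & psi (toC x) = toC A.
Variable e : 'cV[R]_m.
Hypotheses (e_cone : cone rho psi e) (psi_e : psi (toC e) = 1%:M).
Hypothesis T2 : theta_T2 rho psi.
Variables (j : 'cV[Cx R]_m -> 'cV[Cx R]_m) (J : 'cV[Cx R]_m -> 'M[Cx R]_n).
Variables (H : 'cV[Cx R]_m * 'cV[Cx R]_n -> Cx R) (c : set 'cV[R]_n -> Cx R).
Hypothesis j_tube : forall z, tube rho psi z -> tube rho psi (j z).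
Hypothesis j_invol : forall z, tube rho psi z -> j (j z) = z.
Hypothesis j_ie : j (mkC 0 e) = mkC 0 e.
Hypothesis J_hol : holomorphic_on (tube rho psi) J.
Hypothesis H_neq0 : forall z u, tube rho psi z -> H (z, u) != 0.
Hypothesis T5 : theta_T5 rho psi j J H c.

Local Notation bc := (rhoC rho).

(** In a real basis C and its dual basis, period_int says that the matrix of J z
    psi z has integer entries. *)
Lemma J_psi_scalar z : tube rho psi z ->
  exists k : int, J z *m psi z = (k%:~R)%:M.
Proof.
move=> zT; apply: integral_conjugates_scalar => // C UC a b.
have l1 : lat C (C *m delta_mx b 0).
  by exists (delta_mx b 0) => //; rewrite map_delta_mx.
have l2 : lat (dualb rho C) (dualb rho C *m delta_mx a 0).
  by exists (delta_mx a 0) => //; rewrite map_delta_mx.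
have [k kE] := period_int psi_sym T2 j_tube j_invol H_neq0 T5 zT UC l1 l2.
exists k; rewrite -kE; set Y := invmx _ *m _ *m _.
have -> : J z *m psi z *m toC (C *m delta_mx b 0) = toC C *m (Y *m delta_mx b
  (0 : 'I_1)).
  by rewrite toCM toC_delta /Y -!mulmxA mulKVmx ?toC_unit.
rewrite rhoCE toCM sdot_dualb_toC // trmx_mul trmx_delta.
by rewrite toC_delta -rowE -colE !mxE.
Qed.

(** Since J psi z is the scalar k, shift_commute reads as an equation for the
    solution x of J z x = psi (j z) l, namely x = - k l. *)
Lemma psi_j_J z k : tube rho psi z -> J z *m psi z = (k%:~R)%:M ->
  psi (j z) = - (k%:~R *: J z).
Proof.
move=> zT kE; have UJ := J_inj psi_sym T2 j_tube j_invol H_neq0 T5 zT.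
apply/matrixP => a b.
have E : psi (j z) *m toC (delta_mx b (0 : 'I_1)) = - (k%:~R *: J z) *m toC
  (delta_mx b (0 : 'I_1)).
  set l : 'cV[R]_n := delta_mx b 0;
    pose x := invmx (J z) *m (psi (j z) *m toC l).
  have xE : J z *m x = psi (j z) *m toC l by rewrite mulKVmx.
  have -> : psi (j z) *m toC l = J z *m - (k%:~R *: toC l).
    rewrite -xE; congr (_ *m _).
    apply: (@sdot_eqr _ _ (toC (gram rho))); first exact: PC_unit.
    move=> i; have -> : delta_mx i 0 = toC (delta_mx i 0) :> 'cV[Cx R]_n.
      by rewrite toC_delta.
    rewrite -rhoCE (shift_commute psi_sym T2 j_tube j_invol H_neq0 T5 zT xE) kE.
    by rewrite mul_scalar_mx rhoCE sdotZl sdotNl sdotZl (sdot_sym (PC_sym _)).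
  by rewrite mulmxN mulNmx -scalemxAr -scalemxAl.
move: E; rewrite toC_delta -!colE => /matrixP/(_ a 0).
by rewrite !mxE.
Qed.

Lemma psi_psi_j z k : tube rho psi z -> J z *m psi z = (k%:~R)%:M ->
  psi z *m psi (j z) = - (k%:~R ^+ 2)%:M.
Proof.
move=> zT kE; have UJ := J_inj psi_sym T2 j_tube j_invol H_neq0 T5 zT.
rewrite (psi_j_J zT kE) mulmxN -scalemxAr.
have -> : psi z *m J z = (k%:~R)%:M.
  by rewrite -(mulKmx UJ (psi z)) kE -mulmxA mul_scalar_mx -scalemxAr mulVmx
    // scalemx1.
by rewrite scale_scalar_mx expr2.
Qed.

Lemma ie_tube : tube rho psi (mkC 0 e).
Proof. by rewrite /tube /= imM_mkC. Qed.

Lemma psi_ie : psi (mkC 0 e) = (imag R)%:M.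
Proof. by rewrite mkCE toC0 add0r linearZ /= psi_e scalemx1. Qed.

(** At the fixed point ie of j, psi z is the scalar i. *)
Lemma J_psi_ie k : J (mkC 0 e) *m psi (mkC 0 e) = (k%:~R)%:M -> k = 1 \/ k = -1.
Proof.
move=> kE; have := psi_psi_j ie_tube kE.
rewrite j_ie psi_ie -scalar_mxM => /matrixP/(_ (Ordinal n_gt0) (Ordinal n_gt0)).
rewrite !mxE eqxx !mulr1n imag2 => /eqP; rewrite eqr_opp eq_sym.
rewrite -(rmorphXn _ 2) -[X in _ == X]/(1%:~R) eqr_int sqrf_eq1.
by case/orP => /eqP; [left|right].
Qed.

Lemma tube_segment z (t : R) : tube rho psi z -> 0 <= t <= 1 ->
  tube rho psi (mkC 0 e + real_complex R t *: (z - mkC 0 e)).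
Proof.
move=> zT /andP[t0 t1].
have -> : mkC 0 e + real_complex R t *: (z - mkC 0 e) = mkC (t *: reM z) (t *:
  imM z + (1 - t) *: e).
  apply/matrixP => a b; rewrite !mxE.
  by apply: Cx_eq; rewrite ?(ReD, ImD, ReM, ImM, ReN, ImN) /=; ring.
rewrite /tube /= imM_mkC; apply/(coneE psi_sym) => u u0.
have zu := (coneE psi_sym _).1 zT u u0;
  have eu := (coneE psi_sym _).1 e_cone u u0.
rewrite (re_psiD psi_sym) !(re_psiZ psi_sym) mulmxDr -!scalemxAr.
have -> : sdot (t *: (gram rho *m re_psi psi (imM z)) + (1 - t) *: (gram rho
  *m re_psi psi e)) u u =
    t * sdot (gram rho *m re_psi psi (imM z)) u u + (1 - t) * sdot (gram rho
      *m re_psi psi e) u u.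
  by rewrite /sdot mulmxDr mulmxDl -!scalemxAr -!scalemxAl !mxE.
have [->|t_neq0] := eqVneq t 0; first by rewrite mul0r add0r subr0 mul1r.
apply: ltr_pwDl; first by rewrite mulr_gt0 // lt_def t_neq0.
by rewrite mulr_ge0 ?subr_ge0 // ltW.
Qed.

(** Along the segment from ie to z the scalar J psi is continuous and takes
    integer values, hence it is constant. *)
Lemma J_psi_const z k k0 : tube rho psi z -> J z *m psi z = (k%:~R)%:M ->
  J (mkC 0 e) *m psi (mkC 0 e) = (k0%:~R)%:M -> k = k0.
Proof.
move=> zT kE k0E.
(* Opaque, so that the limits are taken in the topology of Cx R. *)
have [q qE] : exists q : R -> Cx R, forall t,
  q t = real_complex R t by exists (real_complex R).
pose p (t : R) := mkC 0 e + q t *: (z - mkC 0 e).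
have p_tube t : 0 <= t <= 1 -> tube rho psi (p t).
  by move=> t01; rewrite /p qE; apply: tube_segment.
pose i0 := Ordinal n_gt0.
pose w t : Cx R := (J (p t) *m psi (p t)) i0 i0.
pose g t := complex.Re (w t).
have g_cont t : 0 <= t <= 1 -> {for t, continuous g}.
  move=> t01; have pT := p_tube t t01.
  have tC : q s @[s --> t] --> q t.
    apply/(@cvgrPdist_le (Cx R) (Cx R)) => eps eps0.
    have [d d0 dE] : exists2 d : R, 0 < d & real_complex R d = eps.
      by case: eps eps0 => a b; rewrite ltcE /= => /andP[/eqP -> a0]; exists a.
    near=> s; rewrite !qE -rmorphB normc_def /= expr0n addr0 sqrtr_sqr -dE lecR.
    by near: s; apply: cvgr_dist_le.
  have pC : p s @[s --> t] --> p t.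
    apply: cvgD; first exact: cvg_cst.
    by apply: cvgZ => //; apply: cvg_cst.
  have JC : J (p s) @[s --> t] --> J (p t).
    apply: (cvg_comp _ _ pC). exact: differentiable_continuous (J_hol pT).
  have JpsiC : w s @[s --> t] --> w t.
    have psip s a : psi (p s) a i0 = psi (mkC 0 e) a i0 + q s * psi (z - mkC 0
      e) a i0.
      by rewrite linearD linearZ !mxE.
    have entry s : w s = \sum_a J (p s) i0 a *
        (psi (mkC 0 e) a i0 + q s * psi (z - mkC 0 e) a i0).
      by rewrite /w mxE; apply: eq_bigr => a _; rewrite psip.
    have Jent a : J (p s) i0 a @[s --> t] --> (J (p t) i0 a : Cx R).
      exact: (cvg_comp _ (fun M : 'M[Cx R]_n => M i0 a) JC (@coord_continuous
        _ _ _ i0 a _)).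
    have X := @cvg_sum_mul_affine (Cx R) _ _ (nbhs_filter t) n (fun a s => J
      (p s) i0 a)
      (fun a => J (p t) i0 a) (fun a => psi (mkC 0 e) a i0)
      (fun a => psi (z - mkC 0 e) a i0) q (q t) Jent tC.
    rewrite -(funext entry) in X.
    rewrite entry. exact: X.
  apply/cvgrPdist_le => d d0.
  have d0' : 0 < (real_complex R d : Cx R) by rewrite ltcR.
  move/(@cvgrPdist_le (Cx R) (Cx R)): JpsiC => /(_ _ d0').
  apply: filterS => s /norm_Re_le; by rewrite ReD ReN.
have g_int t : 0 <= t <= 1 -> exists k : int, g t = k%:~R.
  move=> t01; have [k1 k1E] := J_psi_scalar (p_tube t t01).
  by exists k1; rewrite /g /w k1E mxE eqxx mulr1n -(rmorph_int (real_complex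
    R)).
have Re_int (k1 : int) : complex.Re (k1%:~R : Cx R) = k1%:~R.
  by rewrite -(rmorph_int (real_complex R)).
have g0 : g 0 = k0%:~R.
  by rewrite /g /w /p qE rmorph0 scale0r addr0 k0E mxE eqxx mulr1n.
have g1 : g 1 = k%:~R.
  by rewrite /g /w /p qE rmorph1 scale1r addrC subrK kE mxE eqxx mulr1n.
apply: contrapT => kk0.
(* A half-integer between k0 and k cannot be a value of g. *)
pose a := Num.min k0 k.
pose v : R := a%:~R + 1 / 2.
have gW : {within `[(0 : R), 1], continuous g}.
  apply: continuous_in_subspaceT => t /set_mem; rewrite /= in_itv /= => t01.
  exact: g_cont.
have v_mid : Num.min (g 0) (g 1) <= v <= Num.max (g 0) (g 1).
  have h (x y : int) : x < y -> x%:~R <= (x%:~R + 1 / 2 : R) <= y%:~R.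
    rewrite -lezD1 -(ler_int R) rmorphD /= => xy.
    have half1 : 1 / 2 <= 1 :> R by rewrite ler_pdivrMr // mul1r ler1n.
    apply/andP; split; first by rewrite lerDl divr_ge0.
    by apply: le_trans xy; rewrite lerD2l.
  rewrite g0 g1 /v /a; have [k0k|kk0'|/esym//] := ltgtP k0 k.
    by rewrite min_l ?max_r ?ler_int ?(ltW k0k) //; apply: h.
  by rewrite min_r ?max_l ?ler_int ?(ltW kk0') //; apply: h.
have [t t01 tv] := IVT ler01 gW v_mid.
have [b bE] : exists b : int, g t = b%:~R by apply: g_int;
  rewrite in_itv in t01.
have : (2 * b)%:~R = (2 * a + 1)%:~R :> R.
  by rewrite rmorphD !rmorphM /= -bE tv /v; field.
by move=> /eqP; rewrite eqr_int => /eqP; lia.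
Unshelve. all: by end_near. Qed.

Lemma J_psi_sign : exists2 k : int, k = 1 \/ k = -1 &
  forall z, tube rho psi z -> J z *m psi z = (k%:~R)%:M.
Proof.
have [k kE] := J_psi_scalar ie_tube; exists k; first exact: J_psi_ie kE.
move=> z zT; have [k' k'E] := J_psi_scalar zT.
by rewrite k'E (J_psi_const zT k'E kE).
Qed.

Lemma psi_mul_psi_j z : tube rho psi z -> psi z *m psi (j z) = - 1%:M.
Proof.
move=> zT; have [k k1 kE] := J_psi_sign; rewrite (psi_psi_j zT (kE z zT)).
by case: k1 => ->; rewrite -(rmorphXn _ 2).
Qed.

End Inversion.

(** * Square roots of positive definite matrices *)

Section PolynomialRoot.
Variable R : rcfType.

(** When one more factor X - a is adjoined to the modulus q, a square root p
    modulo q is corrected into p + t q, where t solves an equation of degree 2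
    with reduced discriminant a > 0, or of degree 1 when a is a root of q. *)
Lemma sqrtX_mod_prod (s : seq R) : all (fun a => 0 < a) s ->
  exists p g : {poly R}, p ^+ 2 - 'X = (\prod_(a <- s) ('X - a%:P)) * g.
Proof.
elim: s => [|a s IH] /=; first by exists 0, (- 'X);
  rewrite big_nil mul1r expr0n sub0r.
move=> /andP[a0 /IH[p [g pg]]]; rewrite big_cons;
  set q := \prod_(a <- s) _ in pg *.
have pga : p.[a] ^+ 2 - a = q.[a] * g.[a].
  by have := congr1 (horner^~ a) pg; rewrite !hornerE.
have [t tE] : exists t, g.[a] + 2 * t * p.[a] + t ^+ 2 * q.[a] = 0.
  have [qa0|qa0] := eqVneq q.[a] 0.
    have p0 : p.[a] != 0.
      apply/eqP => pa0; move: pga; rewrite qa0 pa0 mul0r expr0n sub0r => /eqP.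
      by rewrite oppr_eq0 gt_eqF.
    by exists (- g.[a] / (2 * p.[a])); rewrite qa0; field.
  have sa := sqr_sqrtr (ltW a0).
  exists ((Num.sqrt a - p.[a]) / q.[a]); apply: (mulfI qa0); rewrite mulr0.
  have -> : q.[a] * (g.[a] + 2 * ((Num.sqrt a - p.[a]) / q.[a]) * p.[a] +
      ((Num.sqrt a - p.[a]) / q.[a]) ^+ 2 * q.[a]) =
    q.[a] * g.[a] + (Num.sqrt a ^+ 2 - p.[a] ^+ 2) by field.
  by rewrite -pga sa; ring.
have /factor_theorem[h hE] : root (g + 2 * t%:P * p + t%:P ^+ 2 * q) a.
  by apply/eqP; rewrite -[RHS]tE !hornerE.
exists (p + t%:P * q), h.
have -> : ('X - a%:P) * q * h = q * (h * ('X - a%:P)) by ring.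
have -> : (p + t%:P * q) ^+ 2 - 'X = (p ^+ 2 - 'X) + q * (2 * t%:P * p + t%:P
  ^+ 2 * q) by ring.
by rewrite -hE pg; ring.
Qed.

End PolynomialRoot.

Section PositiveCharPoly.
Variables (R : realType) (n' : nat).
Local Notation n := n'.+1.
Variables (S A : 'M[R]_n).
Hypotheses (ST : S^T = S) (S_pos : posdef S).
Hypotheses (A_adj : A^T *m S = S *m A) (A_pos : posdef (S *m A)).

(** For v = x + i y, self-adjointness forces the imaginary part of r to vanish,
    and then the sign of r is that of the form of A at x and y. *)
Lemma eigenvalue_pos (r : Cx R) (v : 'cV[Cx R]_n) : v != 0 ->
  toC A *m v = r *: v ->
  exists2 a : R, 0 < a & r = real_complex R a.
Proof.
move=> v0 Av; case: r Av => a b; set x := reM v; set y := imM v.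
rewrite -(mkC_re_im v) -/x -/y => Av.
have [Ax Ay] : A *m x = a *: x - b *: y /\ A *m y = a *: y + b *: x.
  apply: mkC_inj; have -> : mkC (A *m x) (A *m y) = toC A *m mkC x y.
    by rewrite !mkCE mulmxDr -scalemxAr -!toCM.
  by rewrite Av; apply/matrixP => i k; rewrite !mxE; apply: Cx_eq; rewrite /=;
    ring.
have xx := posdef_ge0 S_pos x; have yy := posdef_ge0 S_pos y.
have xy0 : 0 < sdot S x x + sdot S y y.
  rewrite lt_def addr_ge0 // andbT; apply: contra_neq v0 => xy0.
  rewrite (mkCP v) -/x -/y (posdef_eq0 S_pos (u := x)); last by lra.
  by rewrite (posdef_eq0 S_pos (u := y)); [rewrite toC0 scaler0 addr0|lra].
have b0 : b = 0.
  have := sdot_adj A_adj x y.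
  rewrite Ax Ay !(sdotDl, sdotDr, sdotNl, sdotZl, sdotZr) => h.
  have : b * (sdot S x x + sdot S y y) = 0 by lra.
  by move=> /eqP; rewrite mulf_eq0 (gt_eqF xy0) orbF => /eqP.
exists a; last by rewrite b0.
rewrite ltNge; apply/negP => a_le0.
have pos u : 0 <= sdot S u (A *m u).
  by have := posdef_ge0 A_pos u; rewrite /sdot !mulmxA.
have px := pos x; have py := pos y; move: px py.
rewrite Ax Ay b0 !scale0r subr0 addr0 !sdotZr => px py.
have a_xy : 0 <= a * (sdot S x x + sdot S y y) by lra.
have a0 : a = 0 by apply/eqP; rewrite eq_le a_le0; move: a_xy;
  rewrite pmulr_lge0.
have A_inj (u : 'cV[R]_n) : A *m u = 0 -> u = 0.
  by move=> Au; apply: (posdef_eq0 A_pos);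
    rewrite /sdot mulmxA -mulmxA Au mulmx0 mxE.
have x0 : x = 0 by apply: A_inj; rewrite Ax a0 b0 !scale0r subr0.
have y0 : y = 0 by apply: A_inj; rewrite Ay a0 b0 !scale0r addr0.
by move: xy0; rewrite x0 y0 sdot0l addr0 ltxx.
Qed.

(** The roots of the characteristic polynomial in R[i] are eigenvalues of a
    positive self-adjoint operator, so the complex factorization is real. *)
Lemma char_poly_pos_split : exists2 s : seq R, all (fun a => 0 < a) s &
  char_poly A = \prod_(a <- s) ('X - a%:P).
Proof.
pose p := char_poly (toC A).
have [r rE] := closed_field_poly_normal p.
have p_monic : p \is monic by apply: char_poly_monic.
rewrite (monicP p_monic) scale1r in rE.
have r_pos z : z \in r -> exists2 a : R, 0 < a & z = real_complex R a.
  move=> zr; have : root p z by rewrite rE root_prod_XsubC.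
  have pT : p = char_poly (toC A)^T.
    rewrite /p /char_poly -det_tr; congr (\det _).
    by apply/matrixP => a b; rewrite !mxE eq_sym.
  rewrite pT -eigenvalue_root_char => /eigenvalueP[v vE v0].
  apply: (@eigenvalue_pos _ v^T); first by rewrite -trmx0 (inj_eq trmx_inj).
  by rewrite -[toC A]trmxK -trmx_mul vE linearZ.
exists [seq complex.Re z | z <- r].
  by apply/allP => _ /mapP[z /r_pos[a a0 ->] ->].
apply: (map_poly_inj (real_complex R)); rewrite map_char_poly -toCE -/p rE.
rewrite big_map rmorph_prod /= !big_seq; apply: eq_bigr => z /r_pos[a _ ->].
by rewrite rmorphB /= map_polyX map_polyC.
Qed.

(** A square root of X modulo the characteristic polynomial, evaluated at A. *)
Lemma sqrt_poly : exists p : {poly R}, horner_mx A p *m horner_mx A p = A.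
Proof.
have [s s0 sE] := char_poly_pos_split; have [p [g pg]] := sqrtX_mod_prod s0.
exists p; apply/eqP; rewrite -subr_eq0; apply/eqP.
rewrite -[X in _ - X](horner_mx_X A) -[_ *m _]/(_ * _) -expr2 -rmorphXn
  -rmorphB /=.
by rewrite pg -sE rmorphM /= Cayley_Hamilton mul0r.
Qed.

End PositiveCharPoly.

(** * The Jordan algebra *)

Lemma half_double (K : numFieldType) n (A : 'M[K]_n) : 2^-1 *: (A + A) = A.
Proof.
rewrite scalerDr -scalerDl -[RHS]scale1r; congr (_ *: _).
by field.
Qed.

Section JordanInverse.
Variables (R : realType) (n : nat).
Implicit Types A B : 'M[R]_n.

Lemma double_inj A B : A + A = B + B -> A = B.
Proof.
move=> /(congr1 ( *:%R 2^-1)); rewrite !scalerDr -!scalerDl.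
have -> : 2^-1 + 2^-1 = 1 :> R by field.
by rewrite !scale1r.
Qed.

Lemma half_eq A B : 2^-1 *: A = B -> A = B + B.
Proof.
move=> <-; rewrite -scalerDl -[LHS]scale1r; congr (_ *: _).
by field.
Qed.

(** The two equations make A B and B A idempotents with sum 2. *)
Lemma jordan_inverse_mulmx A B : 2^-1 *: (A *m B + B *m A) = 1%:M ->
  2^-1 *: (A *m A *m B + B *m (A *m A)) = A -> A *m B = 1%:M.
Proof.
move=> /half_eq E1 /half_eq E2; rewrite mulmxA in E2.
have El : A *m A *m B + A *m B *m A = A + A.
  by rewrite -!mulmxA -mulmxDr E1 mulmxDr mulmx1.
have Er : A *m B *m A + B *m A *m A = A + A by rewrite -mulmxDl E1 mulmxDl
  mul1mx.
have ABA : A *m B *m A = A.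
  have XY : A *m A *m B = B *m A *m A.
    by apply: (addIr (A *m B *m A)); rewrite El -Er addrC.
  apply: double_inj; rewrite -[RHS]Er; congr (_ + _).
  by apply: (addrI (A *m A *m B)); rewrite El E2.
have PQ1 : A *m B *m (B *m A) = A *m B.
  apply: (addrI (A *m B *m (A *m B))); rewrite -mulmxDr E1 mulmxDr mulmx1.
  by rewrite [A *m B *m (A *m B)]mulmxA ABA.
have PQ2 : A *m B *m (B *m A) = B *m A.
  apply: (addIr (B *m A *m (B *m A))); rewrite -mulmxDl E1 mulmxDl mul1mx.
  by rewrite -[B *m A *m (B *m A)]mulmxA (mulmxA A) ABA.
by apply: double_inj; rewrite -E1 -[in RHS]PQ2 PQ1.
Qed.

End JordanInverse.

Section Jordan.
Variables (R : realType) (n' m : nat).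
Local Notation n := n'.+1.
Variable (S : 'M[R]_n).
Hypotheses (ST : S^T = S) (S_pos : posdef S).
Variables (f : {linear 'cV[R]_m -> 'M[R]_n}) (e : 'cV[R]_m).
Hypotheses (f_inj : injective f) (f_e : f e = 1%:M).
Hypothesis f_adj : forall x, (f x)^T *m S = S *m f x.
Hypothesis f_inv : forall x, posdef (S *m f x) ->
  exists2 y, posdef (S *m f y) & f x *m f y = 1%:M.

Local Notation pos x := (posdef (S *m f x)).

Let fD x y : f (x + y) = f x + f y. Proof. exact: linearD. Qed.
Let fB x y : f (x - y) = f x - f y. Proof. exact: linearB. Qed.
Let fZ k x : f (k *: x) = k *: f x. Proof. exact: linearZ. Qed.
Let f0 : f 0 = 0. Proof. exact: linear0. Qed.

Lemma posD x y : pos x -> pos y -> pos (x + y).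
Proof.
move=> x0 y0 u u0; rewrite fD mulmxDr /sdot mulmxDr mulmxDl mxE.
by rewrite addr_gt0 //; [apply: x0|apply: y0].
Qed.

(** The form of f x is bounded by a multiple of that of the identity. *)
Lemma half_perturb_pos x : exists2 t : R, t != 0 &
  pos (2^-1 *: e + t *: x) /\ pos (2^-1 *: e - t *: x).
Proof.
have [a a0 aS] := posdef_coercive ST S_pos.
pose T := S *m f x.
pose K := \sum_i \sum_j `|T i j|.
have K0 : 0 <= K by rewrite sumr_ge0 // => i _; rewrite sumr_ge0.
have TK u : `|sdot T u u| <= K * \sum_i u i 0 ^+ 2.
  set s := \sum_i _.
  have us i j : `|u i 0| * `|u j 0| <= s.
    have h k : u k 0 ^+ 2 <= s.
      by rewrite /s (bigD1 k) //= lerDl sumr_ge0 // => l _; rewrite sqr_ge0.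
    have hi := h i; rewrite -(real_normK (num_real (u i 0))) in hi.
    have hj := h j; rewrite -(real_normK (num_real (u j 0))) in hj.
    by have := sqr_ge0 (`|u i 0| - `|u j 0|); nra.
  rewrite /sdot mxE; apply: le_trans (ler_norm_sum _ _ _) _.
  rewrite /K exchange_big mulr_suml; apply: ler_sum => j _.
  rewrite normrM mxE.
  apply: le_trans (_ : (\sum_i `|u i 0| * `|T i j|) * `|u j 0| <= _).
    apply: ler_wpM2r => //; apply: le_trans (ler_norm_sum _ _ _) _.
    by apply: ler_sum => i _; rewrite mxE normrM.
  rewrite !mulr_suml; apply: ler_sum => i _.
  by rewrite (mulrC `|u i 0|) -mulrA ler_wpM2l.
exists (a / (2 * (K + 1))).
  by rewrite gt_eqF // divr_gt0 // mulr_gt0 // ltr_wpDl.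
set t := a / _; have t0 : 0 < t by rewrite divr_gt0 // mulr_gt0 // ltr_wpDl.
have main u : u != 0 -> t * `|sdot T u u| < 2^-1 * sdot S u u.
  move=> u0; have Su := S_pos u0; have := aS u; have := TK u.
  set s := \sum_i _ => Tu au; have s0 : 0 <= s by rewrite sumr_ge0 // => i _;
    rewrite sqr_ge0.
  apply: le_lt_trans (_ : t * (K * s) < _); first by rewrite ler_pM2l.
  have -> : t * (K * s) = 2^-1 * (K / (K + 1) * (a * s)).
    by rewrite /t; field; rewrite gt_eqF // ltr_wpDl.
  rewrite ltr_pM2l ?invr_gt0 //.
  apply: le_lt_trans (_ : K / (K + 1) * sdot S u u < _).
    by rewrite ler_wpM2l // divr_ge0 // addr_ge0.
  by rewrite gtr_pMl // ltr_pdivrMr ?mul1r ?ltrDl // ltr_wpDl.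
have exp_form (s : R) u : sdot (S *m f (2^-1 *: e + s *: x)) u u = 2^-1 * sdot
  S u u + s * sdot T u u.
  rewrite fD !fZ f_e mulmxDr -!scalemxAr mulmx1.
  by rewrite /sdot mulmxDr mulmxDl -!scalemxAr -!scalemxAl !mxE.
clearbody t; split=> u /main; rewrite -?scaleNr exp_form.
  by have := ler_norm (- sdot T u u); rewrite normrN -(ler_pM2l t0); lra.
by have := ler_norm (sdot T u u); rewrite -(ler_pM2l t0); lra.
Qed.

(** Hua's identity: if a and 1 - a are positive, then a (1 - a) is the inverse
    of a^-1 + (1 - a)^-1, so it lies in the range of f. *)
Lemma hua_range x : pos x -> pos (e - x) -> exists y, f y = f x *m (1%:M - f x).
Proof.
move=> x0 ex0; have [y y0 xy] := f_inv x0; have [y' y'0 xy'] := f_inv ex0.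
have [w _ wE] := f_inv (posD y0 y'0); exists w.
rewrite fB f_e in xy'; set A := f x in xy xy' *; set C := 1%:M - A in xy' *.
have yx := mulmx1C xy.
have AC : A *m C = C *m A by rewrite /C mulmxBr mulmxBl mulmx1 mul1mx.
rewrite -[LHS]mul1mx -[RHS]mulmx1 -[X in _ = _ *m X]wE fD mulmxA;
  congr (_ *m _).
rewrite mulmxDr AC -!mulmxA xy mulmx1 mulmxA -AC -mulmxA xy' mulmx1.
by rewrite /C subrK.
Qed.

(** For small t both 1/2 + t a and 1/2 - t a are positive, and their product is
    1/4 - t^2 a^2. *)
Lemma square_range x : exists y, f y = f x *m f x.
Proof.
have [t t0 [p1 p2]] := half_perturb_pos x.
have ee : e - (2^-1 *: e + t *: x) = 2^-1 *: e - t *: x.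
  rewrite opprD addrA; congr (_ - _); rewrite -{1}[e]scale1r -scalerBl.
  by congr (_ *: _); field.
have [|y yE] := @hua_range (2^-1 *: e + t *: x) p1; first by rewrite ee.
exists (t ^- 2 *: (4^-1 *: e - y)).
have {}yE : f y = 4^-1 *: 1%:M - t ^+ 2 *: (f x *m f x).
  have eA : 1%:M - f (2^-1 *: e + t *: x) = 2^-1 *: 1%:M - t *: f x.
    by rewrite -{1}f_e -fB ee fB !fZ f_e.
  rewrite yE eA fD !fZ f_e mulmxBr !mulmxDl.
  rewrite -!scalemxAl -!scalemxAr !mulmx1 !mul1mx !scalerA.
  rewrite (mulrC t) opprD addrA addrK -expr2; congr (_ *: _ - _).
  by field.
rewrite fZ fB fZ yE f_e opprB addrCA subrr addr0 scalerA.
by rewrite mulVf ?scale1r // expf_neq0.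
Qed.

(** Polarization of the squares. *)
Lemma jordan_product_ex x y : exists z, f z = 2^-1 *: (f x *m f y + f y *m f x).
Proof.
have [a aE] := square_range (x + y); have [b bE] := square_range x.
have [d dE] := square_range y; exists (2^-1 *: (a - b - d)).
rewrite fZ !fB aE bE dE fD mulmxDl !mulmxDr; congr (_ *: _).
rewrite addrAC addrA addrK -(addrA (f x *m f x)) addrAC subrr add0r.
by [].
Qed.

Definition jmul x y := projT1 (cid (jordan_product_ex x y)).

Lemma jmulE x y : f (jmul x y) = 2^-1 *: (f x *m f y + f y *m f x).
Proof. by rewrite /jmul; case: cid. Qed.

Lemma jmulC x y : jmul x y = jmul y x.
Proof. by apply: f_inj; rewrite !jmulE addrC. Qed.

Lemma jmul_linear x : linear (jmul x).
Proof.
move=> k y z; apply: f_inj; rewrite jmulE !fD !fZ !jmulE.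
rewrite mulmxDl mulmxDr -scalemxAl -scalemxAr addrACA.
by rewrite scalerDr -(scalerDr k) !scalerA mulrC.
Qed.

Lemma jmul_square x : f (jmul x x) = f x *m f x.
Proof. by rewrite jmulE half_double. Qed.

Lemma jmul_jordan : jordan_algebra jmul.
Proof.
split=> [y k x z|x|x y|x y]; [|exact: jmul_linear|exact: jmulC|].
  by rewrite !(jmulC _ y) jmul_linear.
have := jmul_square x; move: (jmul x x) => s sE; apply: f_inj.
rewrite !jmulE sE -!scalemxAl -!scalemxAr -!scalerDr; congr (_ *: (_ *: _)).
by rewrite !mulmxDl !mulmxDr !mulmxA addrACA.
Qed.

Lemma jmul_unit : jordan_unit jmul e.
Proof.
move=> x; rewrite (jmulC x e); suff -> : jmul e x = x by [].
by apply: f_inj; rewrite jmulE f_e mul1mx mulmx1 half_double.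
Qed.

Lemma f_kernel x : (forall u, sdot S (f x *m u) (f x *m u) = 0) -> x = 0.
Proof.
move=> x0; apply: f_inj; rewrite f0; apply/matrixP => a b.
have := posdef_eq0 S_pos (x0 (delta_mx b 0)); rewrite -colE => /matrixP/(_ a 0).
by rewrite !mxE.
Qed.

Lemma sdot_square x u : sdot S (f (jmul x x) *m u) u = sdot S (f x *m u) (f x
  *m u).
Proof. by rewrite jmul_square -mulmxA (sdot_adj (f_adj x)). Qed.

(** The form of f (x x) at u is the square length of f x u, so in a vanishing
    sum of squares all the terms vanish. *)
Lemma jmul_formally_real : formally_real jmul.
Proof.
move=> s s0 x xs; apply: f_kernel => u.
have : \sum_(y <- s) sdot S (f y *m u) (f y *m u) = 0.
  under eq_bigr => y _ do rewrite -sdot_square.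
  have -> : \sum_(y <- s) sdot S (f (jmul y y) *m u) u = sdot S (f (\sum_(y <-
    s) jmul y y) *m u) u.
    elim/big_rec2: _ => [|y a b _ ->]; first by rewrite f0 mul0mx sdot0l.
    by rewrite fD mulmxDl sdotDl.
  by rewrite s0 f0 mul0mx sdot0l.
move=> /eqP; rewrite psumr_eq0 => [|y _]; last exact: posdef_ge0.
by move=> /allP/(_ x xs)/eqP.
Qed.

Lemma jordan_inverseP x y : jordan_inverse jmul e x y <-> f x *m f y = 1%:M.
Proof.
split=> [[xy xxy]|xy].
  apply: jordan_inverse_mulmx; first by rewrite -jmulE xy.
  by rewrite -[f x *m f x]jmul_square -jmulE xxy.
have yx := mulmx1C xy.
split; apply: f_inj; rewrite jmulE ?jmul_square ?f_e.
  by rewrite xy yx half_double.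
by rewrite -mulmxA xy mulmxA yx mulmx1 mul1mx half_double.
Qed.

Lemma horner_range x (p : {poly R}) : exists y, f y = horner_mx (f x) p.
Proof.
elim/poly_ind: p => [|p k [y yE]]; first by exists 0; rewrite f0 rmorph0.
exists (jmul y x + k *: e); rewrite fD fZ f_e jmulE yE.
rewrite rmorphD rmorphM /= horner_mx_X horner_mx_C scalemx1.
congr (_ + _); have -> : f x *m horner_mx (f x) p = horner_mx (f x) p *m f x.
  by have := comm_horner_mx2 (f x) 'X p; rewrite horner_mx_X.
by rewrite half_double.
Qed.

(** A positive element has a square root among the polynomials in f x, and these
    stay in the range of f; the inverse of the root b is the product of b with
    the inverse of x. *)
Lemma pos_squares : [set x | pos x] = [set jmul x x | x in jordan_invertible
  jmul e].
Proof.
apply/seteqP; split=> [x x0|_ [x [y /jordan_inverseP xy] <-] u u0].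
  have [p pE] := sqrt_poly S_pos (f_adj x) x0.
  have [b bE] := horner_range x p; have [y _ xy] := f_inv x0.
  have bbx : f b *m f b = f x by rewrite bE.
  have yx := mulmx1C xy.
  have bx : f b *m f x = f x *m f b by rewrite -bbx mulmxA.
  have yb : f y *m f b = f b *m f y.
    by rewrite -[LHS]mulmx1 -xy mulmxA -(mulmxA _ (f b)) bx !mulmxA yx mul1mx.
  exists b; last by apply: f_inj; rewrite jmul_square.
  exists (jmul b y); apply/jordan_inverseP.
  by rewrite jmulE yb half_double mulmxA bbx.
have -> : sdot (S *m f (jmul x x)) u u = sdot S (f x *m u) (f x *m u).
  by rewrite -sdot_square (sdot_sym ST) /sdot !mulmxA.
apply: S_pos; apply: contra_neq u0 => xu0.
by rewrite -[u]mul1mx -(mulmx1C xy) -mulmxA xu0 mulmx0.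
Qed.

Lemma jmul_special : jordan_special jmul.
Proof.
exists 'M[R]_n, (range f), f; split=> [|//|x y]; last exact: jmulE.
  split=> [|k _ _ [a _ <-] [b _ <-]|_ _ [a _ <-] [b _ <-]].
  - by exists 0.
  - by exists (k *: a + b); rewrite // linearP.
  - by exists (jmul a b) => //; rewrite jmulE.
split=> [x _|x y _ _ /f_inj //|_ [x _ <-]]; by exists x.
Qed.

End Jordan.

(** * From the identity for j to the Jordan algebra *)

Lemma psi_mul_cplx (R : realType) (n m : nat) (rho : {dot 'cV[R]_n for idfun})
    (psi : {linear 'cV[Cx R]_m -> 'M[Cx R]_n}) (mul : 'cV[R]_m -> 'cV[R]_m ->
      'cV[R]_m) :
  (forall x : 'cV[R]_m, exists2 A, Sym rho A & psi (toC x) = toC A) ->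
  (forall x y, re_psi psi (mul x y) =
    2^-1 *: (re_psi psi x *m re_psi psi y + re_psi psi y *m re_psi psi x)) ->
  forall z w, psi (mul_cplx mul z w) = 2^-1 *: (psi z *m psi w + psi w *m psi
    z).
Proof.
move=> psi_sym mulE z w.
have half : 2^-1 = real_complex R 2^-1 :> Cx R by rewrite fmorphV rmorph_nat.
have mkCD p q (a b c d : 'M[R]_(p,
  q)) : mkC a b + mkC c d = mkC (a + c) (b + d).
  by apply/matrixP => i k; rewrite !mxE; apply: Cx_eq; rewrite /=.
have mkCZ p q (t : R) (a b : 'M[R]_(p,
  q)) : real_complex R t *: mkC a b = mkC (t *: a) (t *: b).
  by apply/matrixP => i k; rewrite !mxE; apply: Cx_eq; rewrite /=; ring.
rewrite !(psiE psi_sym) /mul_cplx reM_mkC imM_mkC !mkCM mkCD half mkCZ.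
have fN x : re_psi psi (- x) = - re_psi psi x by rewrite -scaleN1r (re_psiZ
  psi_sym) scaleN1r.
rewrite !(re_psiD psi_sym) fN !mulE -scalerBr -scalerDr.
congr (mkC (_ *: _) (_ *: _)); first by rewrite opprD addrACA.
by rewrite addrACA; congr (_ + _); rewrite addrC.
Qed.

(** At the points i x with x in the cone, the identity says that the range of
    psi contains the inverse of psi x, which is what the construction of the
    Jordan product requires. *)
Lemma jordan_structure (R : realType) (n m : nat) (hn : (0 < n)%N)
    (rho : {dot 'cV[R]_n for idfun})
    (psi : {linear 'cV[Cx R]_m -> 'M[Cx R]_n})
    (psi_inj : injective psi)
    (psi_sym : forall x : 'cV[R]_m,
       exists2 A, Sym rho A & psi (toC x) = toC A)
    (e : 'cV[R]_m) (psi_e : psi (toC e) = 1%:M)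
    (j : 'cV[Cx R]_m -> 'cV[Cx R]_m)
    (j_tube : forall z, tube rho psi z -> tube rho psi (j z))
    (pj : forall z, tube rho psi z -> psi z *m psi (j z) = - 1%:M) :
  exists mul : 'cV[R]_m -> 'cV[R]_m -> 'cV[R]_m,
    [/\ [/\ jordan_algebra mul, jordan_unit mul e & formally_real mul],
        forall z, tube rho psi z ->
          jordan_inverse (mul_cplx mul) (toC e) z (- j z),
        cone rho psi = [set mul x x | x in jordan_invertible mul e],
        forall x y, jordan_inverse mul e x y ->
          psi (toC x) \in unitmx /\ psi (toC y) = invmx (psi (toC x))
      & (exists2 f : {linear 'cV[R]_m -> 'M[R]_n},
           (forall x, psi (toC x) = toC (f x)) & jordan_hom_Sym rho mul f)
        /\ jordan_special mul].
Proof.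
move: rho psi psi_inj psi_sym psi_e j_tube pj; case: n hn => // n' _.
move=> rho psi psi_inj psi_sym psi_e j_tube pj.
pose f : {linear 'cV[R]_m -> 'M[R]_n'.+1} :=
  HB.pack (re_psi psi) (GRing.isLinear.Build R _ _ _ (re_psi psi)
    (re_psi_linear psi_sym)).
have fE x : psi (toC x) = toC (f x) by exact: psi_toC psi_sym x.
have f_inj : injective f.
  by move=> x y xy; apply/toC_inj/psi_inj; rewrite !fE xy.
have f_e : f e = 1%:M by apply: toC_inj; rewrite -fE psi_e toC1.
have f_adj x : (f x)^T *m gram rho = gram rho *m f x by exact: re_psi_adj.
have f_inv x : posdef (gram rho *m f x) ->
    exists2 y, posdef (gram rho *m f y) & f x *m f y = 1%:M.
  move=> x0; have xT : tube rho psi (mkC 0 x) by rewrite /tube /= imM_mkC;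
    apply/(coneE psi_sym).
  exists (imM (j (mkC 0 x))); first exact/(coneE psi_sym)/j_tube.
  have re0 : re_psi psi 0 = 0 by exact: (linear0 f).
  have := pj _ xT; rewrite !(psiE psi_sym) reM_mkC imM_mkC mkCM re0 !mul0mx
    sub0r add0r.
  rewrite -toC1 -toCN => /(congr1 (@reM _ _ _)); rewrite reM_mkC reM_toC.
  by move=> /oppr_inj.
pose mul := jmul (gram_sym rho) (gram_pos rho) f_e f_inv.
have mulE x y : f (mul x y) = 2^-1 *: (f x *m f y + f y *m f x) by exact: jmulE.
have invP x y : jordan_inverse mul e x y <-> f x *m f y = 1%:M by exact:
  jordan_inverseP.
exists mul; split.
- split; [exact: jmul_jordan|exact: jmul_unit|exact: jmul_formally_real].
- move=> z zT; have zj := pj z zT.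
  have zw : psi z *m psi (- j z) = 1%:M by rewrite linearN /= mulmxN zj opprK.
  have wz := mulmx1C zw.
  have cE := psi_mul_cplx psi_sym mulE.
  split; apply: psi_inj; rewrite !cE.
    by rewrite zw wz half_double psi_e.
  rewrite half_double -mulmxA zw mulmxA wz mulmx1 mul1mx half_double //.
- rewrite -(pos_squares (gram_sym rho) (gram_pos rho) f_inj f_e f_adj f_inv).
  by apply/seteqP; split=> x /(coneE psi_sym).
- move=> x y /invP xy; have xyC : psi (toC x) *m psi (toC y) = 1%:M.
    by rewrite !fE -toCM xy toC1.
  have [Ux _] := mulmx1_unit xyC; split => //.
  by rewrite -[LHS](mulKmx Ux) xyC mulmx1.
- split; last exact: jmul_special.
  by exists f => //; split=> // x; apply: re_psi_Sym.
Qed.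

Theorem theorem15 (R : realType) (n m : nat) (hn : (0 < n)%N)
    (rho : {dot 'cV[R]_n for idfun})
    (psi : {linear 'cV[Cx R]_m -> 'M[Cx R]_n})
    (psi_inj : injective psi)
    (psi_sym : forall x : 'cV[R]_m,
       exists2 A, Sym rho A & psi (toC x) = toC A)
    (e : 'cV[R]_m) (e_cone : cone rho psi e) (psi_e : psi (toC e) = 1%:M)
    (T1 : theta_T1 rho psi) (T2 : theta_T2 rho psi)
    (T3 : theta_T3 rho psi) (T4 : theta_T4 rho psi)
    (j : 'cV[Cx R]_m -> 'cV[Cx R]_m)
    (J : 'cV[Cx R]_m -> 'M[Cx R]_n)
    (H : 'cV[Cx R]_m * 'cV[Cx R]_n -> Cx R)
    (c : set 'cV[R]_n -> Cx R)
    (j_tube : forall z, tube rho psi z -> tube rho psi (j z))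
    (j_hol : holomorphic_on (tube rho psi) j)
    (j_nonaffine : ~ exists (A : 'M[Cx R]_m) (b : 'cV[Cx R]_m),
       forall z, tube rho psi z -> j z = A *m z + b)
    (j_invol : forall z, tube rho psi z -> j (j z) = z)
    (j_ie : j (mkC 0 e) = mkC 0 e)
    (dj_ie : forall h : 'cV[Cx R]_m, 'd j (mkC 0 e) h = - h)
    (J_hol : holomorphic_on (tube rho psi) J)
    (H_hol : holomorphic_on (tube rho psi `*` [set: 'cV[Cx R]_n]) H)
    (H_neq0 : forall z u, tube rho psi z -> H (z, u) != 0)
    (H_norm : H (mkC 0 e, 0) = 1)
    (T5 : theta_T5 rho psi j J H c) :
  (exists mul : 'cV[R]_m -> 'cV[R]_m -> 'cV[R]_m,
    [/\ [/\ jordan_algebra mul, jordan_unit mul e & formally_real mul],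
        forall z, tube rho psi z ->
          jordan_inverse (mul_cplx mul) (toC e) z (- j z),
        cone rho psi = [set mul x x | x in jordan_invertible mul e],
        forall x y, jordan_inverse mul e x y ->
          psi (toC x) \in unitmx /\ psi (toC y) = invmx (psi (toC x))
      & (exists2 f : {linear 'cV[R]_m -> 'M[R]_n},
           (forall x, psi (toC x) = toC (f x)) & jordan_hom_Sym rho mul f)
        /\ jordan_special mul]) /\
  (forall z, tube rho psi z -> psi z \in unitmx) /\
  ((forall z, tube rho psi z -> J z = invmx (psi z)) \/
   (forall z, tube rho psi z -> J z = - invmx (psi z))).
Proof.
have pj := psi_mul_psi_j hn psi_sym e_cone psi_e T2 j_tube j_invol j_ie J_hol
  H_neq0 T5.
have [k k1 kE] := J_psi_sign hn psi_sym e_cone psi_e T2 j_tube j_invol j_ie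
  J_hol H_neq0 T5.
have pU z : tube rho psi z -> psi z \in unitmx by apply: psi_unit.
split; last split => //; last first.
  have JE z : tube rho psi z -> J z = k%:~R *: invmx (psi z).
    by move=> zT; rewrite -[LHS](mulmxK (pU z zT)) kE // mul_scalar_mx.
  by case: k1 => kk; [left|right] => z zT;
    rewrite JE // kk ?scale1r // rmorphN scaleN1r.
exact: jordan_structure.
Qed.
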